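(* Consider i.i.d. observations $(y_1,x_1),\dots,(y_n,x_n)$ drawn from the generalized linear model in the context. Suppose condition (SG) of the context holds and $\|\psi''\|_\infty<c_2<\infty$. Let $\gamma>0$ and $C_1,C_2>0$. Then there is a constant $c>0$, depending only on $\gamma,C_1,C_2$ and the fixed model constants $b_0,C,K_x,c_2$ and the fixed bounds on $c(\sigma)$ (not on $n,d,\varepsilon,\delta$), such that whenever $d\le C_1 n\varepsilon$, $0<\varepsilon<1$ and $0\le\delta\le C_2 n^{-(1+\gamma)}$, $$\inf_{M\in\mathcal M_{\varepsilon,\delta}}\ \sup_{\beta\in\Theta_0}\ \mathbb E\|M(\mathbf y,\mathbf X)-\beta\|_2^2\ \ge\ c\; c(\sigma)\left(\frac dn+\frac{d^2}{n^2\varepsilon^2}\right).$$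
   Context: Generalized linear model: $x\in\mathbb R^d$ has law $f_x$ and, given $x$, $y\in\mathbb R$ has density (with respect to a fixed dominating measure) $f_\beta(y\mid x)=h(y,\sigma)\exp\{(y\,x^\top\beta-\psi(x^\top\beta))/c(\sigma)\}$. The functional form ($\psi$, $h$, $c(\sigma)$) is fixed and known, and for every $\theta\in\mathbb R$, $h(y,\sigma)\exp\{(y\theta-\psi(\theta))/c(\sigma)\}$ is a probability density; $\beta\in\mathbb R^d$ is the unknown parameter. The scale $c(\sigma)>0$ is a fixed constant bounded above and away from zero. Parameter space: $\Theta_0=\{\beta\in\mathbb R^d:\|\beta\|_2\le b_0\}$ with $b_0>0$ a fixed model constant. Condition (SG): $\lambda_{\max}\{\mathbb E(xx^\top)\}\le C$ and $\|u^\top x\|_{\psi_2}\le K_x\|u\|_2$ for every $u\in\mathbb R^d$, for fixed constants $C,K_x<\infty$, where $\|\cdot\|_{\psi_2}$ is the sub-Gaussian Orlicz norm. Differential privacy: a randomized algorithm $M$ on data sets of size $n$ is $(\varepsilon,\delta)$-differentially private if for every two data sets $D,D'$ of size $n$ differing by replacement of one record $(y_i,x_i)$ and every measurable set $S$ of outputs, $\mathbb P(M(D)\in S)\le e^\varepsilon\,\mathbb P(M(D')\in S)+\delta$, the probability being over the randomness of $M$ only. $\mathcal M_{\varepsilon,\delta}$ is the set of all $(\varepsilon,\delta)$-differentially private algorithms with values in $\mathbb R^d$. The expectation in the risk is over the data under $\beta$ and the randomness of $M$. *)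

(* Defs.v *)
From HB Require Import structures.
From mathcomp Require Import all_boot all_order all_algebra.
From mathcomp Require Import all_classical all_reals all_analysis.

Set Implicit Arguments.
Unset Strict Implicit.
Unset Printing Implicit Defensive.

Import Order.TTheory GRing.Theory Num.Theory.
Import numFieldNormedType.Exports.

Local Open Scope classical_set_scope.
Local Open Scope ring_scope.

(* Vectors of R^d are [d.-tuple R], whose canonical sigma-algebra (generated by
   the coordinates) is the Borel one; an observation (y, x) is an element of
   R * R^d and a data set of size n is an n-tuple of observations. *)
Notation obs R d := (R * d.-tuple R)%type.

Section vectors.
Context {R : realType} {d : nat}.
Implicit Types u v : d.-tuple R.

Definition dotp u v : R := \sum_(i < d) tnth u i * tnth v i.

Definition l2norm u : R := Num.sqrt (\sum_(i < d) tnth u i ^+ 2).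

Definition subv u v : d.-tuple R := [tuple tnth u i - tnth v i | i < d].

Definition l2ball (b0 : R) : set (d.-tuple R) := [set u | l2norm u <= b0].

End vectors.

Section sub_gaussian.
Context {R : realType}.

(* inf {t > 0 : E exp(Z^2 / t^2) <= 2}, equal to +oo if there is no such t. *)
Definition psi2_norm (disp : measure_display) (T : measurableType disp)
    (P : probability T R) (Z : T -> R) : \bar R :=
  ereal_inf [set t%:E | t in
    [set t : R | 0 < t /\ ('E_P[fun w => expR ((Z w / t) ^+ 2)] <= 2%:E)%E]].

Definition second_moment_mx (d : nat) (fx : probability (d.-tuple R) R) :
    'M[R]_d :=
  \matrix_(i, j) fine 'E_fx[fun x : d.-tuple R => tnth x i * tnth x j].

(* Meaningful for symmetric matrices only: [eigenvalue] is about eigenvalues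
   in R. *)
Definition lambda_max (d : nat) (A : 'M[R]_d) : R :=
  sup [set a : R | eigenvalue A a].

Definition cond_SG (C Kx : R) (d : nat) (fx : probability (d.-tuple R) R) :=
  lambda_max (second_moment_mx fx) <= C /\
  forall u : d.-tuple R,
    (psi2_norm fx (fun x => dotp u x) <= (Kx * l2norm u)%:E)%E.

End sub_gaussian.

Section glm.
Context {R : realType}.

Definition sup_norm (f : R -> R) : \bar R :=
  ereal_sup (range (fun t : R => (`|f t|)%:E)).

Definition glm_density (psi : R -> R) (h : R -> R -> R) (cs : R -> R)
    (sigma theta y : R) : R :=
  h y sigma * expR ((y * theta - psi theta) / cs sigma).

Definition probability_density (nu : {measure set R -> \bar R}) (f : R -> R) :=
  [/\ measurable_fun [set: R] f, (forall y, 0 <= f y)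
    & (\int[nu]_y (f y)%:E = 1)%E].

(* P is the law of (y, x) when x has law fx and, given x, y has density
   f_beta(. | x) with respect to nu. *)
Definition glm_law (psi : R -> R) (h : R -> R -> R) (cs : R -> R) (sigma : R)
    (nu : {measure set R -> \bar R}) (d : nat)
    (fx : probability (d.-tuple R) R) (beta : d.-tuple R)
    (P : probability (obs R d) R) :=
  forall A : set (obs R d), measurable A ->
    P A = (\int[fx]_x \int[nu]_y
      (\1_A (y, x) * glm_density psi h cs sigma (dotp x beta) y)%:E)%E.

(* Q is the n-fold product P^{(x) n}, i.e. the joint law of n i.i.d. draws
   from P; it is determined by its values on measurable boxes. *)
Definition iid_law (disp : measure_display) (T : measurableType disp)
    (P : probability T R) (n : nat) (Q : probability (n.-tuple T) R) :=
  forall A : 'I_n -> set T, (forall i, measurable (A i)) ->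
    Q [set D | forall i, A i (tnth D i)] = (\prod_(i < n) P (A i))%E.

End glm.

Section privacy.
Context {R : realType} {n d : nat}.

Definition algorithm := R.-pker (n.-tuple (obs R d)) ~> (d.-tuple R).

Definition neighbors (D D' : n.-tuple (obs R d)) :=
  exists i : 'I_n, forall j, j != i -> tnth D j = tnth D' j.

Definition dp_algorithms (eps delta : R) : set algorithm :=
  [set M : algorithm | forall D D', neighbors D D' ->
     forall S : set (d.-tuple R), measurable S ->
       (M D S <= (expR eps)%:E * M D' S + delta%:E)%E].

Definition sq_risk (Q : probability (n.-tuple (obs R d)) R)
    (M : algorithm) (beta : d.-tuple R) : \bar R :=
  (\int[Q]_D \int[M D]_m (l2norm (subv m beta) ^+ 2)%:E)%E.

(* Pn beta is the law of the data under the parameter beta. *)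
Definition private_minimax_risk (Theta : set (d.-tuple R))
    (Pn : d.-tuple R -> probability (n.-tuple (obs R d)) R)
    (eps delta : R) : \bar R :=
  ereal_inf [set ereal_sup [set sq_risk (Pn beta) M beta | beta in Theta]
            | M in dp_algorithms eps delta].

End privacy.

(* Main.v *)
Require Import Defs.
From HB Require Import structures.
From mathcomp Require Import all_boot all_order all_algebra.
From mathcomp Require Import all_classical all_reals all_analysis.
From mathcomp Require Import measurable_realfun.
From mathcomp Require Import ring lra.
Import Order.TTheory GRing.Theory Num.Theory.
Import numFieldNormedType.Exports.
Local Open Scope classical_set_scope.
Local Open Scope ring_scope.

Set Implicit Arguments.
Unset Strict Implicit.
Unset Printing Implicit Defensive.

(** The proof is a tracing (or score) attack on the output of the algorithm.
Let a = b0 / sqrt d, so that the box [-a, a]^d lies in the parameter ball, and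
let S_j(beta; y, x) = (y - psi'(x.beta)) x_j / c(sigma) be the score of one
record.  For a parameter beta of the box, an output m is first clamped to the
box and then correlated with the scores of the records,

  attack = sum_i sum_j w(beta_j) (m_j - beta_j) S_j(beta; record i),

with the weight w(t) = 1 - (t/a)^2, which vanishes at the two ends of
[-a, a].  If the risk is small, the mean of this statistic has to be large on
average over beta, whereas it is always small.

It is large on average.  For a fixed data set, the sum of the scores is the
logarithmic derivative of the likelihood p_beta, so that
(d/dt)[w(t) (m_j - t) p_t] = [w'(t) (m_j - t) - w(t) + w(t) (m_j - t) score_j] p_t.
The integral of this over beta_j vanishes because w does so at the ends.
Integrating over the uniform prior on the box and exchanging the two
integrals, the mean of the attack is (2/3) d up to a bias term controlled by
the risk ([stein_bound], [completeness]).  The integration by parts is done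
along one coordinate and for a fixed data set, hence nothing is ever
differentiated under an integral sign.

It is always small, for two reasons.  By Young's inequality and the
independence of the records the mean is at most of order
sqrt(risk * n d * lam), where lam bounds the Fisher information of one record
([attack_le_info]); this gives the rate d / n.  By privacy, replacing the i-th
record by a fresh one z changes the mean of the i-th summand by at most
(e^eps - 1) times its mean absolute value, plus 2 delta times its supremum.
After the replacement the output is independent of z, so that the summand is
centered and its mean absolute value is at most sqrt(lam * risk)
([attack_le_dp]); summing over i gives the rate d^2 / (n eps)^2, provided that
n delta is small.  Since the outputs are clamped, the supremum of the i-th
summand is bounded by a multiple of the size of its score, so that a first
moment of the score suffices.  When n is smaller than a constant,
n delta may fail to be small; then d^2 / (n eps)^2 is bounded by a constant
multiple of d / n and the first rate is enough.

Two facts about the model are used, and both come from exponential moments.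
The normalization of the exponential family at theta + u bounds the
moment generating function of the residual at theta by exp(s u^2), which forces
mean zero and variance O(s) ([Rint_sub1], [Rint_sub2_le]); the Orlicz norm
bound on u.x controls E (u.x)^2 directly ([psi2_second_moment]). *)

(** * Elementary inequalities *)

Section elementary.
Context {R : realType}.

Lemma young (k x y : R) : 0 < k -> x * y <= (k * x ^+ 2 + k^-1 * y ^+ 2) / 2.
Proof.
move=> k0; rewrite -subr_ge0.
rewrite (_ : _ - _ = k^-1 * (k * x - y) ^+ 2 * 2^-1); last first.
  by field; rewrite gt_eqF.
by rewrite mulr_ge0// mulr_ge0 ?sqr_ge0// invr_ge0 ltW.
Qed.

Lemma norm_le_half_sqr (x : R) : `|x| <= (x ^+ 2 + 1) / 2.
Proof.
have := young `|x| 1 (@ltr01 R).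
by rewrite mulr1 invr1 !mul1r expr1n real_normK ?num_real.
Qed.

Lemma sum_delta (d : nat) (j : 'I_d) (F : 'I_d -> R) :
  \sum_k (k == j)%:R * F k = F j.
Proof.
rewrite (bigD1 j)//= eqxx mul1r big1 ?addr0// => k /negbTE ->.
by rewrite mul0r.
Qed.

End elementary.

(** * Integrable real-valued functions *)

Definition L1 (disp : measure_display) (T : measurableType disp) (R : realType)
    (mu : {measure set T -> \bar R}) (f : T -> R) : Prop :=
  mu.-integrable [set: T] (EFin \o f).

Section L1_theory.
Context {disp : measure_display} {T : measurableType disp} {R : realType}.
Variable mu : {measure set T -> \bar R}.
Implicit Types f g : T -> R.

Lemma L1_measurable f : L1 mu f -> measurable_fun setT f.
Proof. by move=> /integrableP[/measurable_EFinP]. Qed.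

Lemma L1D f g : L1 mu f -> L1 mu g -> L1 mu (fun x => f x + g x).
Proof. by move=> hf hg; exact: (integrableD measurableT hf hg). Qed.

Lemma L1B f g : L1 mu f -> L1 mu g -> L1 mu (fun x => f x - g x).
Proof. by move=> hf hg; exact: (integrableB measurableT hf hg). Qed.

Lemma L1Zl k f : L1 mu f -> L1 mu (fun x => k * f x).
Proof. by move=> hf; exact: (integrableZl measurableT k hf). Qed.

Lemma L1Zr k f : L1 mu f -> L1 mu (fun x => f x * k).
Proof. by move=> hf; exact: (integrableZr measurableT k hf). Qed.

Lemma L1_sum (I : Type) (s : seq I) (F : I -> T -> R) :
  (forall i, L1 mu (F i)) -> L1 mu (fun x => \sum_(i <- s) F i x).
Proof.
move=> h; apply: (eq_integrable measurableT (fun x => (\sum_(i <- s) (F i x)%:E)%E)).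
  by move=> x _; rewrite sumEFin.
by apply: (integrable_sum measurableT) => i _; exact: h.
Qed.

Lemma L1_le f g : measurable_fun setT f -> (forall x, `|f x| <= g x) ->
  L1 mu g -> L1 mu f.
Proof.
move=> mf fg; apply: le_integrable => //; first exact/measurable_EFinP.
by move=> x _ /=; rewrite lee_fin (le_trans (fg x))// ler_norm.
Qed.

Lemma L1_norm f : L1 mu f -> L1 mu (fun x => `|f x|).
Proof. by move=> hf; exact: (integrable_norm hf). Qed.

Lemma EFin_Rint f : L1 mu f -> (\int[mu]_x f x)%:E = (\int[mu]_x (f x)%:E)%E.
Proof. by move=> h; rewrite /Rintegral fineK//; exact: integrable_fin_num. Qed.

Lemma RintD f g : L1 mu f -> L1 mu g ->
  \int[mu]_x (f x + g x) = \int[mu]_x f x + \int[mu]_x g x.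
Proof. exact: RintegralD. Qed.

Lemma RintB f g : L1 mu f -> L1 mu g ->
  \int[mu]_x (f x - g x) = \int[mu]_x f x - \int[mu]_x g x.
Proof. exact: RintegralB. Qed.

Lemma RintZl k f : L1 mu f -> \int[mu]_x (k * f x) = k * \int[mu]_x f x.
Proof. exact: RintegralZl. Qed.

Lemma RintZr k f : L1 mu f -> \int[mu]_x (f x * k) = \int[mu]_x f x * k.
Proof. exact: RintegralZr. Qed.

Lemma le_Rint f g : L1 mu f -> L1 mu g -> (forall x, f x <= g x) ->
  \int[mu]_x f x <= \int[mu]_x g x.
Proof. by move=> ? ? fg; apply: le_Rintegral => // x _; exact: fg. Qed.

Lemma Rint_sum (I : Type) (s : seq I) (F : I -> T -> R) :
  (forall i, L1 mu (F i)) ->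
  \int[mu]_x (\sum_(i <- s) F i x) = \sum_(i <- s) \int[mu]_x F i x.
Proof.
move=> h; elim: s => [|i s ih].
  rewrite big_nil; under eq_Rintegral do rewrite big_nil.
  by rewrite /Rintegral integral0.
rewrite big_cons -ih -RintD//; last exact: L1_sum.
by apply: eq_Rintegral => x _; rewrite big_cons.
Qed.

Lemma L1_ge0_lty f : measurable_fun setT f -> (forall x, 0 <= f x) ->
  (\int[mu]_x (f x)%:E < +oo)%E -> L1 mu f.
Proof.
move=> mf f0 h; apply/integrableP; split; first exact/measurable_EFinP.
by under eq_integral do rewrite gee0_abs ?lee_fin//.
Qed.

End L1_theory.

Section L1_probability.
Context {disp : measure_display} {T : measurableType disp} {R : realType}.
Variable mu : probability T R.
Implicit Types f g : T -> R.

Lemma L1_cst k : L1 mu (fun=> k).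
Proof. exact: finite_measure_integrable_cst. Qed.

Lemma Rint_cst k : \int[mu]_x k = k.
Proof. by rewrite Rintegral_cst// [X in fine X]probability_setT mulr1. Qed.

Lemma L1_bounded f b : measurable_fun setT f -> (forall x, `|f x| <= b) ->
  L1 mu f.
Proof. by move=> mf fb; apply: L1_le mf fb (L1_cst b). Qed.

End L1_probability.

(** * Measures given by a density *)

Section density.
Context {disp : measure_display} {T : measurableType disp} {R : realType}.
Variables (m P : {measure set T -> \bar R}) (f : T -> R).
Hypothesis mf : measurable_fun setT f.
Hypothesis f0 : forall x, 0 <= f x.
Hypothesis PE : forall A, measurable A ->
  P A = (\int[m]_x (\1_A x * f x)%:E)%E.

Import HBNNSimple.

Let integral_density_nnsfun (g : {nnsfun T >-> R}) :
  (\int[P]_x (g x)%:E = \int[m]_x (g x * f x)%:E)%E.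
Proof.
under [LHS]eq_integral do rewrite fimfunE -fsumEFin//.
rewrite [LHS]ge0_integral_fsum//; last 2 first.
  - by move=> r; exact/measurable_EFinP/measurableT_comp.
  - by move=> n x _; rewrite EFinM nnfun_muleindic_ge0.
under [RHS]eq_integral.
  move=> x xD; rewrite EFinM fimfunE -fsumEFin// ge0_mule_fsuml; last first.
    by move=> r; rewrite EFinM nnfun_muleindic_ge0.
  over.
have mi r : measurable_fun setT (fun x => (\1_(g @^-1` [set r]) x : R)).
  by apply: measurable_indic.
rewrite [RHS]ge0_integral_fsum//; last 2 first.
  - move=> r; apply/measurable_EFinP; apply: measurable_funM => //.
    by apply: measurable_funM => //.
  - move=> n x _; rewrite mule_ge0//; last by rewrite lee_fin f0.
    by rewrite EFinM nnfun_muleindic_ge0.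
apply: eq_fsbigr => r _.
rewrite integralZl_indic_nnsfun//= integral_indic// setIT PE//.
have [r0|r0] := leP 0 r.
  rewrite -ge0_integralZl//.
  - by apply: eq_integral => x _; rewrite -!EFinM mulrA.
  - by apply/measurable_EFinP; apply: measurable_funM.
  - by move=> x _; rewrite lee_fin mulr_ge0.
(* a negative level is not attained, so that both sides vanish *)
rewrite preimage_nnfun0//.
under eq_integral do rewrite indic0 mul0r.
by under [RHS]eq_integral do rewrite indic0 mulr0 mul0e; rewrite integral0 mule0.
Qed.

(** The hypothesis on [P] is the case of indicators; it passes to simple functions
by linearity and to nonnegative functions by monotone convergence. *)
Lemma ge0_integral_density (g : T -> R) :
  measurable_fun setT g -> (forall x, 0 <= g x) ->
  (\int[P]_x (g x)%:E = \int[m]_x (g x * f x)%:E)%E.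
Proof.
move=> mg g0; have mG : measurable_fun setT (EFin \o g) by exact/measurable_EFinP.
pose g_ := nnsfun_approx measurableT mG.
transitivity (lim (\int[P]_x (g_ n x)%:E @[n --> \oo])%E).
  rewrite -monotone_convergence//=.
  - apply: eq_integral => x _; apply/esym/cvg_lim => //=.
    by apply: cvg_nnsfun_approx => // y _; rewrite lee_fin.
  - by move=> n; exact/measurable_EFinP/measurable_funTS.
  - by move=> n ? _; rewrite lee_fin.
  - by move=> ? _ ? ? mn; rewrite lee_fin; exact/lefP/nd_nnsfun_approx.
transitivity (lim (\int[m]_x (g_ n x * f x)%:E @[n --> \oo])%E).
  by apply: congr_lim; apply/funext => n /=; exact: integral_density_nnsfun.
rewrite -monotone_convergence//=.
- apply: eq_integral => x _; apply/cvg_lim => //=.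
  under eq_fun do rewrite EFinM.
  rewrite EFinM; apply: cvgeZr => //.
  by apply: cvg_nnsfun_approx => // y _; rewrite lee_fin.
- by move=> n; apply/measurable_EFinP; apply: measurable_funM.
- by move=> n ? _; rewrite lee_fin mulr_ge0.
- move=> x _ a b ab; rewrite lee_fin ler_wpM2r//.
  exact/lefP/nd_nnsfun_approx.
Qed.

Lemma L1_density (g : T -> R) : measurable_fun setT g ->
  L1 P g <-> L1 m (fun x => g x * f x).
Proof.
move=> mg; rewrite /L1; split => /integrableP[_ h]; apply/integrableP.
- split; first by apply/measurable_EFinP; exact: measurable_funM.
  move: h; under eq_integral do rewrite /=.
  rewrite (ge0_integral_density (g := fun x => `|g x|))//; last exact: measurableT_comp.
  by under [X in _ -> (X < _)%E]eq_integral do rewrite /= normrM (ger0_norm (f0 _)).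
- split; first exact/measurable_EFinP.
  rewrite (ge0_integral_density (g := fun x => `|g x|))//; last exact: measurableT_comp.
  by move: h; under eq_integral do rewrite /= normrM (ger0_norm (f0 _)).
Qed.

Lemma Rint_density (g : T -> R) : L1 P g ->
  \int[P]_x g x = \int[m]_x (g x * f x).
Proof.
move=> ig; have mg := L1_measurable ig.
rewrite /Rintegral integralE [in RHS]integralE; congr (fine (_ - _)).
- transitivity (\int[P]_x (g^\+%R x)%:E)%E.
    by apply: eq_integral => x _; rewrite -[LHS]/((EFin \o g)^\+%E x) funerpos.
  rewrite ge0_integral_density//; last exact: measurable_funrpos.
  apply: eq_integral => x _.
  rewrite -[RHS]/((EFin \o (fun x => (g x * f x)%R))^\+%E x).
  by rewrite funerpos /= /funrpos maxr_pMl// mul0r.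
- transitivity (\int[P]_x (g^\-%R x)%:E)%E.
    by apply: eq_integral => x _; rewrite -[LHS]/((EFin \o g)^\-%E x) funerneg.
  rewrite ge0_integral_density//; last exact: measurable_funrneg.
  apply: eq_integral => x _.
  rewrite -[RHS]/((EFin \o (fun x => (g x * f x)%R))^\-%E x).
  by rewrite funerneg /= /funrneg maxr_pMl// mul0r mulNr.
Qed.

End density.

(** * Product laws on tuples *)

Section tuple_update.
Context {disp : measure_display} {T : measurableType disp} {n : nat}.
Implicit Types (D : n.-tuple T) (i j : 'I_n) (z : T).

Definition tupd D i z : n.-tuple T :=
  [tuple if j == i then z else tnth D j | j < n].

Lemma tnth_tupd D i z j : tnth (tupd D i z) j = if j == i then z else tnth D j.
Proof. by rewrite tnth_mktuple. Qed.

Lemma tnth_tupd_id D i z : tnth (tupd D i z) i = z.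
Proof. by rewrite tnth_tupd eqxx. Qed.

Lemma tnth_tupd_neq D i z j : j != i -> tnth (tupd D i z) j = tnth D j.
Proof. by rewrite tnth_tupd => /negbTE ->. Qed.

Lemma measurable_tupd i :
  measurable_fun setT (fun u : n.-tuple T * T => tupd u.1 i u.2).
Proof.
apply/measurable_fun_tnthP => j.
rewrite (_ : _ \o _ =
  (fun u : n.-tuple T * T => if j == i then u.2 else tnth u.1 j)); last first.
  by apply/funext => u /=; rewrite tnth_tupd.
case: (j == i); first exact: measurable_snd.
exact: (measurableT_comp (measurable_tnth j) measurable_fst).
Qed.

Definition box (A : 'I_n -> set T) : set (n.-tuple T) :=
  [set D | forall i, A i (tnth D i)].

Lemma measurable_box (A : 'I_n -> set T) :
  (forall i, measurable (A i)) -> measurable (box A).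
Proof.
move=> mA; rewrite [X in measurable X](_ : _ =
    \bigcap_(i in [set: 'I_n]) ((fun D : n.-tuple T => tnth D i) @^-1` A i)).
  apply: fin_bigcap_measurable => // i _.
  by rewrite -[X in measurable X]setTI; apply: measurable_tnth.
by apply/seteqP; split=> [D DA i _|D DA i]; exact: DA.
Qed.

(** The boxes form a pi-system that generates the sigma-algebra of the tuples. *)
Lemma tuple_measure_unique (R : realType)
    (m1 m2 : {measure set (n.-tuple T) -> \bar R}) : (m1 setT < +oo)%E ->
  (forall A, (forall i, measurable (A i)) -> m1 (box A) = m2 (box A)) ->
  forall E, measurable E -> m1 E = m2 E.
Proof.
move=> m1oo m12 E mE.
pose G : set (set (n.-tuple T)) :=
  [set box A | A in [set A : 'I_n -> set T | forall i, measurable (A i)]].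
have boxT : box (fun=> setT) = setT by apply/seteqP; split.
apply: (g_sigma_algebra_measure_unique G _ (fun=> setT)).
- by move=> _ [A mA <-]; exact: measurable_box.
- by move=> _; exists (fun=> setT).
- by rewrite bigcup_const.
- move=> _ _ [A mA <-] [B mB <-]; exists (fun i => A i `&` B i).
    by move=> i; exact: measurableI.
  by apply/seteqP; split=> [D h|D [h1 h2] i]; split=> // i; case: (h i).
- by move=> _ [A mA <-]; exact: m12.
- by [].
- move: E mE; apply: smallest_sub; first exact: smallest_sigma_algebra.
  rewrite -bigcup_seq => _ [k _ [A mA <-]].
  apply: sub_sigma_algebra.
  exists (fun j => if j == k then A else setT).
    by move=> j; case: ifP.
  rewrite setTI; apply/seteqP; split=> D h /=.
    by have := h k; rewrite eqxx.
  by move=> j; case: eqP => // ->.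
Qed.

End tuple_update.

Section iid.
Context {disp : measure_display} {T : measurableType disp} {R : realType}.
Context {n : nat} (P : probability T R) (Q : probability (n.-tuple T) R).
Hypothesis PQ : iid_law P Q.

Let upd i (u : n.-tuple T * T) := tupd u.1 i u.2.

(** Replacing one entry of an i.i.d. sample by a fresh draw does not change its
law: both laws agree on boxes.  All the uses of independence below go through
this statement. *)
Lemma iid_law_resample i E : measurable E ->
  Q E = pushforward (Q \x P)%E (upd i) E.
Proof.
pose mupd := isMeasurableFun.Build _ _ _ _ _ (@measurable_tupd _ T n i).
pose f : {mfun (n.-tuple T * T)%type >-> n.-tuple T} := HB.pack (upd i) mupd.
apply: (@tuple_measure_unique _ _ _ _ Q (pushforward (Q \x P)%E f)).
  by rewrite [X in (X < _)%E]probability_setT ltry.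
move=> A mA; rewrite [LHS]PQ// -[RHS]/((Q \x P)%E (upd i @^-1` box A)).
have -> : upd i @^-1` box A
    = box (fun j => if j == i then setT else A j) `*` A i.
  apply/seteqP; split=> [[D z] h|[D z] [/= h1 h2] j] /=.
    split; last by have := h i; rewrite /= tnth_tupd_id.
    move=> j; case: eqP => // /eqP ji.
    by have := h j; rewrite /= tnth_tupd_neq.
  rewrite /= tnth_tupd; have := h1 j.
  by case: eqP => [->|].
rewrite product_measure1E//; last first.
  by apply: measurable_box => j; case: ifP.
rewrite [X in (X * _)%E]PQ; last by move=> j; case: ifP.
rewrite (bigD1 i)//= [in RHS](bigD1 i)//= eqxx probability_setT mul1e muleC.
by congr (_ * _)%E; apply: eq_bigr => j /negbTE ->.
Qed.

Lemma ge0_resample i (F : n.-tuple T -> \bar R) :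
  measurable_fun setT F -> (forall D, 0 <= F D)%E ->
  (\int[Q]_D F D = \int[Q]_D \int[P]_z F (tupd D i z))%E.
Proof.
move=> mF F0.
pose mupd := isMeasurableFun.Build _ _ _ _ _ (@measurable_tupd _ T n i).
pose f : {mfun (n.-tuple T * T)%type >-> n.-tuple T} := HB.pack (upd i) mupd.
rewrite (eq_measure_integral (pushforward (Q \x P)%E f)); last first.
  by move=> A mA _; exact: iid_law_resample.
rewrite ge0_integral_pushforward//=; last exact: measurable_tupd.
rewrite preimage_setT (fubini_tonelli1 (F \o upd i))//.
exact: (measurableT_comp mF (measurable_tupd i)).
by move=> x; exact: F0.
Qed.

Lemma L1_resample i (F : n.-tuple T -> R) : L1 Q F ->
  L1 (Q \x P)%E (fun u => F (tupd u.1 i u.2)).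
Proof.
move=> iF; have mF := L1_measurable iF.
have mFu : measurable_fun setT (fun u => F (tupd u.1 i u.2)).
  exact: (measurableT_comp mF (measurable_tupd i)).
apply/integrable12ltyP; first exact/measurable_EFinP.
have /integrableP[_] := iF; rewrite (ge0_resample i)//.
by apply/measurable_EFinP; exact: measurableT_comp.
Qed.

Lemma Rint_resample i (F : n.-tuple T -> R) : L1 Q F ->
  (forall D, L1 P (fun z => F (tupd D i z))) ->
  \int[Q]_D F D = \int[Q]_D \int[P]_z F (tupd D i z).
Proof.
move=> iF iF2; have mF := L1_measurable iF.
pose mupd := isMeasurableFun.Build _ _ _ _ _ (@measurable_tupd _ T n i).
pose f : {mfun (n.-tuple T * T)%type >-> n.-tuple T} := HB.pack (upd i) mupd.
have iFu := L1_resample i iF.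
rewrite {1}/Rintegral (eq_measure_integral (pushforward (Q \x P)%E f)); last first.
  by move=> A mA _; exact: iid_law_resample.
rewrite integral_pushforward//=; last exact/measurable_EFinP.
rewrite -integral12_prod_meas1//; congr fine; apply: eq_integral => D _ /=.
by rewrite EFin_Rint.
exact: measurable_tupd.
Qed.

Lemma L1_resample_int i (F : n.-tuple T -> R) : L1 Q F ->
  (forall D, L1 P (fun z => F (tupd D i z))) ->
  L1 Q (fun D => \int[P]_z F (tupd D i z)).
Proof.
move=> iF iF2; have iFu := L1_resample i iF.
apply: (eq_integrable measurableT _ _ _ (integrable_fubini_F iFu)) => D _.
by rewrite /= EFin_Rint.
Qed.

Lemma L1_marginal i (g : T -> R) : L1 P g -> L1 Q (fun D => g (tnth D i)).
Proof.
move=> ig; have mg := L1_measurable ig.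
have mgi : measurable_fun setT (fun D : n.-tuple T => g (tnth D i)).
  by apply: (measurableT_comp mg); exact: measurable_tnth.
apply/integrableP; split; first exact/measurable_EFinP.
rewrite (ge0_resample i)//; last first.
  by apply: measurableT_comp => //; exact/measurable_EFinP.
under eq_integral do under eq_integral do rewrite /= tnth_tupd_id.
rewrite integral_cst// [X in (_ * X)%E]probability_setT mule1.
by case/integrableP : ig.
Qed.

Lemma Rint_marginal i (g : T -> R) : L1 P g ->
  \int[Q]_D g (tnth D i) = \int[P]_z g z.
Proof.
move=> ig; rewrite (@Rint_resample i _ (L1_marginal i ig)); last first.
  by move=> D; apply: (eq_integrable measurableT _ _ _ ig) => z _; rewrite /= tnth_tupd_id.
under eq_Rintegral do under eq_Rintegral do rewrite tnth_tupd_id.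
by rewrite Rint_cst.
Qed.

(** Resampling one coordinate pulls its factor out of the integral of the product
of the remaining ones. *)
Lemma ge0_iid_prod (g : 'I_n -> T -> R) :
  (forall i, measurable_fun setT (g i)) -> (forall i z, 0 <= g i z) ->
  (\int[Q]_D (\prod_(i < n) g i (tnth D i))%:E
   = \prod_(i < n) \int[P]_z (g i z)%:E)%E.
Proof.
move=> mg g0.
have main (s : seq 'I_n) : uniq s ->
    (\int[Q]_D (\prod_(i <- s) g i (tnth D i))%:E
     = \prod_(i <- s) \int[P]_z (g i z)%:E)%E.
  elim: s => [_|i s ih /= /andP[is_ us]].
    rewrite big_nil; under eq_integral do rewrite big_nil.
    by rewrite integral_cst// [X in (_ * X)%E]probability_setT mule1.
  have mp : measurable_fun setT (fun D => \prod_(j <- s) g j (tnth D j)).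
    apply: measurable_prod => j _.
    by apply: (measurableT_comp (mg j)); exact: measurable_tnth.
  have mt : measurable_fun setT (fun D : n.-tuple T => g i (tnth D i)).
    by apply: (measurableT_comp (mg i)); exact: measurable_tnth.
  have p0 D : 0 <= \prod_(j <- s) g j (tnth D j) by apply: prodr_ge0.
  rewrite (ge0_resample i); last 2 first.
    - apply/measurable_EFinP; under eq_fun do rewrite big_cons.
      exact: measurable_funM.
    - by move=> D; rewrite lee_fin; apply: prodr_ge0.
  rewrite big_cons -ih// muleC -ge0_integralZr//; last 3 first.
    - by apply: measurableT_comp => //.
    - by move=> D _; rewrite lee_fin.
    - by apply: integral_ge0 => z _; rewrite lee_fin.
  apply: eq_integral => D _.
  rewrite -ge0_integralZl//; last 3 first.
    - by apply/measurable_EFinP.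
    - by move=> z _; rewrite lee_fin.
    - by rewrite lee_fin.
  apply: eq_integral => z _; rewrite big_cons tnth_tupd_id -EFinM mulrC.
  congr (_ * _)%:E; apply: eq_big_seq => j js.
  by rewrite tnth_tupd_neq//; apply: contraNneq is_ => <-.
by rewrite main ?index_enum_uniq.
Qed.

End iid.

Section density_measure.
Context {disp : measure_display} {T : measurableType disp} {R : realType}.
Variables (m : {measure set T -> \bar R}) (f : T -> R).
Hypothesis mf : measurable_fun setT f.
Hypothesis f0 : forall x, 0 <= f x.

(** The proofs [mf] and [f0] are arguments so that the measure structure declared
below can be inferred from the term. *)
Definition density_measure (mf : measurable_fun setT f)
    (f0 : forall x, 0 <= f x) (A : set T) : \bar R :=
  (\int[m]_(x in A) (f x)%:E)%E.

Local Notation dm := (density_measure mf f0).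

Let dm0 : dm set0 = 0%E.
Proof. by rewrite /density_measure integral_set0. Qed.

Let dm_ge0 A : (0 <= dm A)%E.
Proof. by apply: integral_ge0 => x _; rewrite lee_fin. Qed.

Let dm_sigma_additive : semi_sigma_additive dm.
Proof.
move=> /= F mF tF mUF; rewrite /density_measure; apply: cvg_toP.
  apply: ereal_nondecreasing_is_cvgn => a b ab.
  apply: lee_sum_nneg_natr => // k _ _.
  by apply: integral_ge0 => /= x Fkx; rewrite lee_fin.
rewrite ge0_integral_bigcup//=.
- by apply/measurable_EFinP; exact: measurable_funTS.
- by move=> x _; rewrite lee_fin.
Qed.

HB.instance Definition _ := isMeasure.Build _ _ _ dm
  dm0 dm_ge0 dm_sigma_additive.

Lemma density_measureE A : measurable A ->
  dm A = (\int[m]_x (\1_A x * f x)%:E)%E.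
Proof.
move=> mA; rewrite /density_measure integral_mkcond; apply: eq_integral => x _.
rewrite patchE indicE; case: ifP => _; first by rewrite mul1r.
by rewrite mul0r.
Qed.

End density_measure.

(** * Likelihood ratios and existence of product laws *)

Section iid_density.
Context {disp : measure_display} {T : measurableType disp} {R : realType}.
Context {n : nat} (P0 P1 : probability T R) (Q0 Q1 : probability (n.-tuple T) R).
Hypothesis PQ0 : iid_law P0 Q0.
Hypothesis PQ1 : iid_law P1 Q1.
Variable L : T -> R.
Hypothesis mL : measurable_fun setT L.
Hypothesis L_ge0 : forall z, 0 <= L z.
Hypothesis P1E : forall A, measurable A ->
  P1 A = (\int[P0]_z (\1_A z * L z)%:E)%E.

(** A product of likelihood ratios is the likelihood ratio of the product laws: the
integral over a box factorizes, and boxes determine a measure. *)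
Lemma iid_density E : measurable E ->
  Q1 E = (\int[Q0]_D (\1_E D * \prod_(i < n) L (tnth D i))%:E)%E.
Proof.
have mp : measurable_fun setT (fun D : n.-tuple T => \prod_(i < n) L (tnth D i)).
  apply: measurable_prod => j _.
  by apply: (measurableT_comp mL); exact: measurable_tnth.
have p0 (D : n.-tuple T) : 0 <= \prod_(i < n) L (tnth D i) by apply: prodr_ge0.
move=> mE; rewrite -(density_measureE Q0 mp p0 mE).
apply: (tuple_measure_unique (m1 := Q1)) => //.
  by rewrite [X in (X < _)%E]probability_setT ltry.
move=> A mA; rewrite [LHS]PQ1//.
rewrite -[RHS]/(density_measure Q0 mp p0 (box A)) density_measureE//; last first.
  exact: measurable_box.
transitivity (\int[Q0]_D
    (\prod_(i < n) (\1_(A i) (tnth D i) * L (tnth D i)))%:E)%E; last first.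
  apply: eq_integral => D _; rewrite big_split /=; congr (_ * _)%:E.
  rewrite indicE; have [DA|DA] := boolP (D \in box A).
    apply: big1 => i _; rewrite indicE mem_set//.
    by move: DA; rewrite inE; apply.
  apply/eqP; rewrite prodf_seq_eq0; apply: contraNT DA.
  move=> /hasPn /= h; rewrite inE => i /=.
  have := h i (mem_index_enum i); rewrite indicE; case: (boolP (_ \in _)).
    by rewrite inE.
  by rewrite eqxx.
rewrite (ge0_iid_prod PQ0 (g := fun i z => \1_(A i) z * L z)).
- by apply: eq_bigr => i _; exact: P1E.
- by move=> i; apply: measurable_funM => //; exact: measurable_indic.
- by move=> i z; rewrite mulr_ge0.
Qed.

End iid_density.

Section iid_exists.
Context {disp : measure_display} {T : measurableType disp} {R : realType}.
Variable P : probability T R.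

Lemma iid_exists n : exists Q : probability (n.-tuple T) R, iid_law P Q.
Proof.
elim: n => [|n [Q PQ]].
  exists (\d_([tuple] : 0.-tuple T)) => A mA.
  by rewrite big_ord0 /= diracE mem_set// => -[].
pose f (u : T * n.-tuple T) : n.+1.-tuple T := [the n.+1.-tuple T of u.1 :: u.2].
have mf : measurable_fun setT f by apply: measurable_cons.
pose mu_ : {measure set (n.+1.-tuple T) -> \bar R} :=
  pushforward (P \x Q)%E f.
pose mu := mu_ mf.
have mu1 : mu setT = 1%E.
  rewrite -[LHS]/((P \x Q)%E (f @^-1` setT)) preimage_setT -setXTT.
  rewrite product_measure1E//.
  by rewrite [X in (X * _)%E]probability_setT [X in (_ * X)%E]probability_setT mul1e.
pose pmu := Measure_isProbability.Build _ _ _ mu mu1.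
pose Q' : probability (n.+1.-tuple T) R := HB.pack (Measure.sort mu) pmu.
exists Q' => A mA.
rewrite -[LHS]/((P \x Q)%E (f @^-1` box A)).
have -> : f @^-1` box A = A ord0 `*` box (fun i => A (lift ord0 i)).
  apply/seteqP; split=> [[z D] h|[z D] [/= h1 h2] j] /=.
    by split; [exact: (h ord0)|move=> i; have := h (lift ord0 i); rewrite tnthS].
  have [->//|] := eqVneq j ord0; rewrite -/(j \in predC1 ord0).
  by case: (unliftP ord0 j) => [i ->|->]; rewrite ?eqxx// tnthS => _; exact: h2.
rewrite product_measure1E//; last by apply: measurable_box => i.
by rewrite big_ord_recl [X in (_ * X)%E]PQ.
Qed.

End iid_exists.

(** * Expectations under differential privacy *)

Section dp_expectation.
Context {disp : measure_display} {Y : measurableType disp} {R : realType}.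
Variables (mu mu' : probability Y R) (e delta : R).
Hypothesis e_ge1 : 1 <= e.
Hypothesis delta_ge0 : 0 <= delta.

(** Layer-cake formula: privacy is applied to the sets [f > t], and the additive
term is paid only for the levels t between 0 and [b]. *)
Lemma dp_expectation_ge0 (nu nu' : probability Y R) (f : Y -> R) (b : R) :
  (forall A, measurable A -> (nu A <= e%:E * nu' A + delta%:E)%E) ->
  measurable_fun setT f -> (forall y, 0 <= f y <= b) ->
  \int[nu]_y f y <= e * \int[nu']_y f y + delta * b.
Proof.
move=> dp mf f0b.
have f0 y : 0 <= f y by case/andP: (f0b y).
have b0 : 0 <= b by have /andP[h1 h2] := f0b point; exact: le_trans h1 h2.
have i1 : L1 nu f by apply: L1_bounded (b) mf _ => y; rewrite ger0_norm//; case/andP: (f0b y).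
have i2 : L1 nu' f by apply: L1_bounded (b) mf _ => y; rewrite ger0_norm//; case/andP: (f0b y).
rewrite -lee_fin EFinD EFinM EFin_Rint// [in X in (_ <= X)%E]EFinM EFin_Rint//.
pose mmf := isMeasurableFun.Build _ _ _ _ _ mf.
pose F : {mfun Y >-> R} := HB.pack f mmf.
pose X : {RV nu >-> R} := F.
pose X' : {RV nu' >-> R} := F.
have E1 : (\int[nu]_y (f y)%:E = \int[lebesgue_measure]_(r in `[0%R, +oo[) ccdf X r)%E.
  by rewrite -ge0_expectation_ccdf// unlock.
have E2 : (\int[nu']_y (f y)%:E = \int[lebesgue_measure]_(r in `[0%R, +oo[) ccdf X' r)%E.
  by rewrite -ge0_expectation_ccdf// unlock.
rewrite E1 E2.
apply: (@le_trans _ _ (\int[lebesgue_measure]_(r in `[0%R, +oo[)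
   (e%:E * ccdf X' r + (delta * \1_(`[0, b[) r)%:E))%E).
  apply: ge0_le_integral => //.
  - by apply: measurable_funTS; exact: ccdf_measurable.
  - apply: measurable_funTS; apply: emeasurable_funD.
      by apply: measurable_funeM; exact: ccdf_measurable.
    by apply/measurable_EFinP; apply: measurable_funM => //; exact: measurable_indic.
  - move=> r; rewrite /= in_itv/= andbT => r0.
    rewrite indicE; have [rb|br] := ltP r b.
      rewrite mem_set ?mulr1; last by rewrite /= in_itv/= r0.
      apply: dp.
      by have := mf measurableT _ (measurable_itv `]r, +oo[); rewrite setTI.
    rewrite [X in (X <= _)%E](_ : _ = 0%E); last first.
      rewrite -[LHS]/(nu (f @^-1` `]r, +oo[)) [X in nu X](_ : _ = set0) ?measure0//.
      apply/seteqP; split=> // y /=; rewrite in_itv/= andbT => /(le_lt_trans br).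
      by rewrite ltNge; case/andP: (f0b y) => _ ->.
    apply: adde_ge0; last by rewrite lee_fin mulr_ge0.
    by rewrite mule_ge0// lee_fin (le_trans _ e_ge1).
rewrite ge0_integralD//=; first last.
- apply: measurable_funTS; apply/measurable_EFinP.
  by apply: measurable_funM => //; exact: measurable_indic.
- by move=> r _; rewrite lee_fin mulr_ge0.
- by apply: measurable_funTS; apply: measurable_funeM; exact: ccdf_measurable.
- by move=> r _; rewrite mule_ge0// lee_fin (le_trans _ e_ge1).
apply: leeD.
  rewrite ge0_integralZl//.
  - by apply: measurable_funTS; exact: ccdf_measurable.
  - by rewrite lee_fin (le_trans _ e_ge1).
under eq_integral do rewrite EFinM.
rewrite ge0_integralZl//; first last.
- by apply: measurable_funTS; apply/measurable_EFinP; exact: measurable_indic.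
rewrite integral_indic// lee_wpmul2l//.
rewrite (@le_trans _ _ (lebesgue_measure (`[0%R, b[%classic : set R)))//.
  by apply: le_measure; rewrite ?inE//; exact: measurableI.
rewrite lebesgue_measure_itv/= lte_fin; case: ifPn => _; last by rewrite lee_fin.
by rewrite oppr0 adde0.
Qed.

(** The positive part is compared from [mu] to [mu'] and the negative part from
[mu'] to [mu].  Writing the error in terms of the absolute value under [mu']
only is what makes it computable when [mu'] does not depend on [f]. *)
Lemma dp_expectation (f : Y -> R) (b : R) :
  (forall A, measurable A -> (mu A <= e%:E * mu' A + delta%:E)%E) ->
  (forall A, measurable A -> (mu' A <= e%:E * mu A + delta%:E)%E) ->
  measurable_fun setT f -> (forall y, `|f y| <= b) ->
  \int[mu]_y f y <= \int[mu']_y f y + (e - 1) * \int[mu']_y `|f y| + 2 * delta * b.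
Proof.
move=> dp dp' mf fb.
have b0 : 0 <= b by exact: le_trans (normr_ge0 _) (fb point).
have mp := measurable_funrpos mf; have mn := measurable_funrneg mf.
have pb y : 0 <= f^\+ y <= b.
  by rewrite funrpos_ge0/= /funrpos ge_max b0 (le_trans (ler_norm _) (fb y)).
have nb y : 0 <= f^\- y <= b.
  rewrite funrneg_ge0/= /funrneg ge_max b0 andbT.
  by rewrite (le_trans (ler_norm _))// normrN fb.
have ip (nu : probability Y R) : L1 nu f^\+.
  by apply: L1_bounded (b) mp _ => y; rewrite ger0_norm; case/andP: (pb y).
have inn (nu : probability Y R) : L1 nu f^\-.
  by apply: L1_bounded (b) mn _ => y; rewrite ger0_norm; case/andP: (nb y).
have fE (nu : probability Y R) :
    \int[nu]_y f y = \int[nu]_y f^\+ y - \int[nu]_y f^\- y.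
  rewrite -RintB//; apply: eq_Rintegral => y _.
  exact: (esym (congr1 (fun h : Y -> R => h y) (funrposBneg f))).
have nE : \int[mu']_y `|f y| = \int[mu']_y f^\+ y + \int[mu']_y f^\- y.
  rewrite -RintD//; apply: eq_Rintegral => y _.
  exact: (esym (congr1 (fun h : Y -> R => h y) (funrposDneg f))).
have h1 := dp_expectation_ge0 dp mp pb.
have h2 := dp_expectation_ge0 dp' mn nb.
rewrite !fE nE; move: h1 h2.
set p := \int[mu]_y f^\+ y; set q := \int[mu]_y f^\- y.
set p' := \int[mu']_y f^\+ y; set q' := \int[mu']_y f^\- y => h1 h2.
have q0 : 0 <= q by apply: Rintegral_ge0 => y _; case/andP: (nb y).
have q0' : 0 <= q' by apply: Rintegral_ge0 => y _; case/andP: (nb y).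
have db : 0 <= delta * b by rewrite mulr_ge0.
(* 1/e >= 2 - e turns the lower bound (q' - delta b)/e on q into one that is
   linear in e *)
suff : (2 - e) * q' - delta * b <= q by lra.
have [h|h] := leP ((2 - e) * q' - delta * b) 0; first exact: le_trans h q0.
have e0 : 0 < e by apply: lt_le_trans e_ge1.
rewrite -(ler_pM2l e0).
have s1 : 0 <= (e - 1) * (e - 1) * q' by rewrite mulr_ge0// -expr2 sqr_ge0.
have s2 : 0 <= (e - 1) * (delta * b) by rewrite mulr_ge0// subr_ge0.
lra.
Qed.

End dp_expectation.

Section kernel_integral.
Context {d1 d2 : measure_display} {X : measurableType d1}
  {Y : measurableType d2} {R : realType}.

(** [k x] seen as a probability measure rather than as a mere measure. *)
Definition kernel_prob (k : R.-pker X ~> Y) (x : X) : set Y -> \bar R := k x.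

HB.instance Definition _ (k : R.-pker X ~> Y) (x : X) :=
  isMeasure.Build _ _ _ (kernel_prob k x) (measure0 (k x)) (measure_ge0 (k x))
    (@measure_semi_sigma_additive _ _ _ (k x)).

HB.instance Definition _ (k : R.-pker X ~> Y) (x : X) :=
  Measure_isProbability.Build _ _ _ (kernel_prob k x) (prob_kernel (s := k) x).

Variable k : R.-pker X ~> Y.

Lemma norm_Rint_le (mu : probability Y R) (u : Y -> R) b :
  measurable_fun setT u -> (forall y, `|u y| <= b) -> `|\int[mu]_y u y| <= b.
Proof.
move=> mf fb; have i := L1_bounded mu mf fb.
rewrite (le_trans (le_normr_Rintegral _ i))// -[leRHS](Rint_cst mu).
by apply: le_Rint => //; [exact: L1_norm|exact: L1_cst].
Qed.

Lemma measurable_kernel_Rint (u : Y -> R) b :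
  measurable_fun setT u -> (forall y, `|u y| <= b) ->
  measurable_fun setT (fun x => \int[kernel_prob k x]_y u y).
Proof.
move=> mf fb.
have i x := L1_bounded (kernel_prob k x) mf fb.
rewrite (_ : (fun x => _) =
    (fun x => fine (\int[k x]_y (u y + b)%:E)%E - b)); last first.
  apply/funext => x.
  rewrite -[fine _]/(\int[kernel_prob k x]_y (u y + b)).
  by rewrite (RintD (i x) (L1_cst _ b)) Rint_cst addrK.
(* u is shifted by b to become nonnegative *)
suff m1 : measurable_fun setT (fun x => fine (\int[k x]_y (u y + b)%:E)%E).
  exact: (measurable_funB m1 (measurable_cst b)).
apply: measurableT_comp => //.
apply: (measurable_fun_integral_finite_kernel (fun z : X * Y => (u z.2 + b)%:E) k) => /=.
  move=> z; rewrite lee_fin -lerBlDr sub0r.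
  by have := fb z.2; rewrite ler_norml => /andP[].
apply/measurable_EFinP; apply: measurable_funD => //.
by apply: measurableT_comp.
Qed.

End kernel_integral.

(** * Upper bounds on the tracing attack *)

Section attack.
Context {dT dY : measure_display} {T : measurableType dT}
  {Y : measurableType dY} {R : realType} {n d : nat}.
Variables (P : probability T R) (Q : probability (n.-tuple T) R).
Variable M : R.-pker (n.-tuple T) ~> Y.
Hypothesis PQ : iid_law P Q.
(* [v j m] is the j-th coordinate of a bounded error of the output m, and
   [sum_j v j m * S j z] measures how much m depends on the record z *)
Variables (v : 'I_d -> Y -> R) (b : R).
Hypothesis mv : forall j, measurable_fun setT (v j).
Hypothesis vb : forall j y, `|v j y| <= b.
Variables (S : 'I_d -> T -> R) (lam : R).
Hypothesis mS : forall j, measurable_fun setT (S j).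
Hypothesis S_mean : forall j, \int[P]_z S j z = 0.
Hypothesis S_cov : forall u : 'I_d -> R,
  (\int[P]_z ((\sum_j u j * S j z) ^+ 2)%:E <= (lam * \sum_j u j ^+ 2)%:E)%E.

Let V j D := \int[kernel_prob M D]_y v j y.
Let g D := \int[kernel_prob M D]_y (\sum_j v j y ^+ 2).

Let mcomb (u : 'I_d -> R) : measurable_fun setT (fun z => \sum_j u j * S j z).
Proof.
apply: measurable_sum => j; apply: measurable_funM => //; exact: measurable_cst.
Qed.

Let L1_comb2 (u : 'I_d -> R) : L1 P (fun z => (\sum_j u j * S j z) ^+ 2).
Proof.
apply: L1_ge0_lty; [|by move=> z; exact: sqr_ge0|].
  by apply: measurable_funX; exact: mcomb.
by apply: le_lt_trans (S_cov u) _; rewrite ltry.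
Qed.

Let le_comb2 (u : 'I_d -> R) :
  \int[P]_z ((\sum_j u j * S j z) ^+ 2) <= lam * \sum_j u j ^+ 2.
Proof. by rewrite -lee_fin EFin_Rint. Qed.

Let L1_S2 j : L1 P (fun z => S j z ^+ 2).
Proof.
apply: (eq_integrable measurableT _ _ _ (L1_comb2 (fun k => (k == j)%:R))) => z _.
by rewrite /= sum_delta.
Qed.

Let le_S2 j : \int[P]_z (S j z ^+ 2) <= lam.
Proof.
have := le_comb2 (fun k => (k == j)%:R).
rewrite (_ : \sum_k _ = 1) ?mulr1; last first.
  by under eq_bigr do rewrite expr2; rewrite sum_delta eqxx.
by under eq_Rintegral do rewrite sum_delta.
Qed.

Let L1_SS j k : L1 P (fun z => S j z * S k z).
Proof.
apply: (L1_le (g := fun z => S j z ^+ 2 + S k z ^+ 2)).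
- exact: measurable_funM.
- move=> z; rewrite normrM -(real_normK (num_real (S j z))) -(real_normK (num_real (S k z))).
  have := sqr_ge0 (`|S j z| - `|S k z|); have := normr_ge0 (S j z).
  have := normr_ge0 (S k z); nra.
- exact: L1D.
Qed.

Let L1_S j : L1 P (S j).
Proof.
apply: (L1_le (mS j) (fun z => norm_le_half_sqr (S j z))).
by apply: L1Zr; apply: L1D => //; exact: L1_cst.
Qed.

Let le_absS j : \int[P]_z `|S j z| <= (lam + 1) / 2.
Proof.
apply: (@le_trans _ _ (\int[P]_z ((S j z ^+ 2 + 1) / 2))).
  apply: le_Rint; [exact: L1_norm| |by move=> z; exact: norm_le_half_sqr].
  by apply: L1Zr; apply: L1D => //; exact: L1_cst.
rewrite RintZr; last by apply: L1D => //; exact: L1_cst.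
rewrite RintD//; last exact: L1_cst.
by rewrite Rint_cst ler_wpM2r// lerD2r le_S2.
Qed.

Let mV j : measurable_fun setT (V j).
Proof. exact: measurable_kernel_Rint (mv j) (vb j). Qed.

Let Vb j D : `|V j D| <= b.
Proof. exact: norm_Rint_le. Qed.

Let vvb j k y : `|v j y * v k y| <= b * b.
Proof. by rewrite normrM ler_pM. Qed.

Let mvv j k : measurable_fun setT (fun y => v j y * v k y).
Proof. exact: measurable_funM. Qed.

Let G j k D := \int[kernel_prob M D]_y (v j y * v k y).

Let mG j k : measurable_fun setT (G j k).
Proof. exact: measurable_kernel_Rint (mvv j k) (vvb j k). Qed.

Let Gb j k D : `|G j k D| <= b * b.
Proof. exact: norm_Rint_le. Qed.

Let gE D : g D = \sum_j G j j D.
Proof.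
rewrite /g Rint_sum; last first.
  by move=> j; apply: (L1_bounded _ (mvv j j) (vvb j j)).
by apply: eq_bigr => j _; apply: eq_Rintegral => y _; rewrite expr2.
Qed.

Let L1_g : L1 Q g.
Proof.
rewrite (_ : g = fun D => \sum_j G j j D); last by apply/funext => D; exact: gE.
by apply: L1_sum => j; apply: (L1_bounded _ (mG j j) (Gb j j)).
Qed.

Let L1_v j D : L1 (kernel_prob M D) (v j).
Proof. exact: (L1_bounded _ (mv j) (vb j)). Qed.

Let L1_vv j k D : L1 (kernel_prob M D) (fun y => v j y * v k y).
Proof. exact: (L1_bounded _ (mvv j k) (vvb j k)). Qed.

Let mti j i : measurable_fun setT (fun D : n.-tuple T => S j (tnth D i)).
Proof. by apply: (measurableT_comp (mS j)); exact: measurable_tnth. Qed.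

Let L1_pair j (i i' : 'I_n) :
  L1 Q (fun D => S j (tnth D i) * S j (tnth D i')).
Proof.
apply: (L1_le (g := fun D => S j (tnth D i) ^+ 2 + S j (tnth D i') ^+ 2)).
- exact: measurable_funM.
- move=> D; rewrite normrM -(real_normK (num_real (S j (tnth D i)))).
  rewrite -(real_normK (num_real (S j (tnth D i')))).
  have := sqr_ge0 (`|S j (tnth D i)| - `|S j (tnth D i')|).
  have := normr_ge0 (S j (tnth D i)).
  have := normr_ge0 (S j (tnth D i')); nra.
- apply: L1D; first exact: (L1_marginal PQ i (L1_S2 j)).
  exact: (L1_marginal PQ i' (L1_S2 j)).
Qed.

Let pair0 j (i i' : 'I_n) : i != i' ->
  \int[Q]_D (S j (tnth D i) * S j (tnth D i')) = 0.
Proof.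
move=> ii'.
have E D z : S j (tnth (tupd D i z) i) * S j (tnth (tupd D i z) i')
    = S j z * S j (tnth D i').
  by rewrite tnth_tupd_id tnth_tupd_neq// eq_sym.
rewrite (@Rint_resample _ _ _ _ _ _ PQ i _ (L1_pair j i i')); last first.
  move=> D; apply: (eq_integrable measurableT _ _ _ (L1Zr (S j (tnth D i')) (L1_S j))).
  by move=> z _; rewrite /= E.
transitivity (\int[Q]_D (0 : R)); last by rewrite Rint_cst.
apply: eq_Rintegral => D _.
under eq_Rintegral do rewrite E.
by rewrite RintZr// S_mean mul0r.
Qed.

Let X j (D : n.-tuple T) := \sum_(i < n) S j (tnth D i).

Let X2E j D : X j D ^+ 2 =
  \sum_(i < n) \sum_(i' < n) S j (tnth D i) * S j (tnth D i').
Proof. by rewrite expr2 big_distrlr. Qed.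

Let L1_X2 j : L1 Q (fun D => X j D ^+ 2).
Proof.
rewrite (_ : (fun D => _) = (fun D => \sum_(i < n) \sum_(i' < n)
    S j (tnth D i) * S j (tnth D i'))); last by apply/funext => D; exact: X2E.
by apply: L1_sum => i; apply: L1_sum => i'; exact: L1_pair.
Qed.

(** The records are independent and the scores centered, so that only the diagonal
terms contribute. *)
Let le_X2 j : \int[Q]_D (X j D ^+ 2) <= n%:R * lam.
Proof.
under eq_Rintegral do rewrite X2E.
rewrite Rint_sum; last by move=> i; apply: L1_sum => i'; exact: L1_pair.
rewrite -[X in X%:R](card_ord n) mulr_natl -sumr_const; apply: ler_sum => i _.
rewrite Rint_sum; last by move=> i'; exact: L1_pair.
rewrite (bigD1 i)//= big1 ?addr0; last by move=> i' ii'; rewrite pair0// eq_sym.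
under eq_Rintegral do rewrite -expr2.
by rewrite (Rint_marginal PQ i (L1_S2 j)).
Qed.

Lemma L1_attack i : L1 Q (fun D => \sum_j V j D * S j (tnth D i)).
Proof.
apply: L1_sum => j.
apply: (L1_le (g := fun D => b * `|S j (tnth D i)|)).
- exact: measurable_funM.
- by move=> D; rewrite normrM ler_wpM2r.
- by apply: L1Zl; apply: L1_norm; exact: (L1_marginal PQ i (L1_S j)).
Qed.

(** Young's inequality between the error of the output and the total score, whose
second moment is at most n lam in each of the d coordinates. *)
Lemma attack_le_info (k : R) : 0 < k ->
  \int[Q]_D (\sum_(i < n) \sum_j V j D * S j (tnth D i))
  <= (k * \int[Q]_D g D + n%:R * d%:R * lam / k) / 2.
Proof.
move=> k0.
have L1X2 : L1 Q (fun D => \sum_j X j D ^+ 2) by apply: L1_sum => j; exact: L1_X2.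
apply: (@le_trans _ _ (\int[Q]_D ((k * g D + k^-1 * \sum_j X j D ^+ 2) * 2^-1))).
  apply: le_Rint.
  - by apply: L1_sum => i; exact: L1_attack.
  - by apply: L1Zr; apply: L1D; apply: L1Zl.
  move=> D; rewrite exchange_big /=.
  rewrite gE !mulr_sumr -big_split /= mulr_suml; apply: ler_sum => j _.
  rewrite -mulr_sumr -/(X j D) mulrC -(RintZl _ (L1_v j D)).
  rewrite /G.
  rewrite -(RintZl _ (L1_vv j j D)).
  rewrite -[k^-1 * _](Rint_cst (kernel_prob M D)) -RintD; last 2 first.
  - by apply: L1Zl; exact: L1_vv.
  - exact: L1_cst.
  rewrite -RintZr; last first.
    by apply: L1D; [apply: L1Zl; exact: L1_vv|exact: L1_cst].
  apply: le_Rint; first by apply: L1Zl; exact: L1_v.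
    apply: L1Zr; apply: L1D; last exact: L1_cst.
    by apply: L1Zl; exact: L1_vv.
  by move=> y; rewrite mulrC -expr2; exact: young.
rewrite RintZr; last by apply: L1D; apply: L1Zl.
rewrite ler_wpM2r// RintD; [|exact: L1Zl|exact: L1Zl].
rewrite !RintZl// lerD2l mulrC ler_wpM2r ?invr_ge0 ?(ltW k0)//.
rewrite Rint_sum; last by move=> j; exact: L1_X2.
rewrite -mulrA [d%:R * _]mulrC mulrA -[X in _ * X%:R](card_ord d) mulr_natr -sumr_const.
by apply: ler_sum => j _; exact: le_X2.
Qed.

Variables (e delta : R).
Hypothesis e_ge1 : 1 <= e.
Hypothesis delta_ge0 : 0 <= delta.
Hypothesis dpM : forall D i z A, measurable A ->
  (M (tupd D i z) A <= e%:E * M D A + delta%:E)%E /\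
  (M D A <= e%:E * M (tupd D i z) A + delta%:E)%E.

Let phi z y := \sum_j v j y * S j z.

Let mphi z : measurable_fun setT (phi z).
Proof. by apply: measurable_sum => j; apply: measurable_funM. Qed.

Let phib z y : `|phi z y| <= b * \sum_j `|S j z|.
Proof.
rewrite mulr_sumr; apply: le_trans (ler_norm_sum _ _ _) _.
by apply: ler_sum => j _; rewrite normrM ler_wpM2r.
Qed.

Let RintV z D : \int[kernel_prob M D]_y phi z y = \sum_j V j D * S j z.
Proof.
rewrite Rint_sum; last by move=> j; apply: L1Zr.
by apply: eq_bigr => j _; rewrite RintZr.
Qed.

Let phi2E z y : phi z y ^+ 2 =
  \sum_j \sum_k (S j z * S k z) * (v j y * v k y).
Proof.
rewrite expr2 big_distrlr /=; apply: eq_bigr => j _; apply: eq_bigr => k _; ring.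
Qed.

(** The square is expanded so that the record z and the data set D separate in each
term; the mean over z is then a finite sum, without an exchange of integrals. *)
Let Rint_phi2 z D : \int[kernel_prob M D]_y (phi z y ^+ 2) =
  \sum_j \sum_k (S j z * S k z) * G j k D.
Proof.
under eq_Rintegral do rewrite phi2E.
rewrite Rint_sum; last by move=> j; apply: L1_sum => k; apply: L1Zl.
apply: eq_bigr => j _; rewrite Rint_sum; last by move=> k; apply: L1Zl.
by apply: eq_bigr => k _; rewrite RintZl.
Qed.

Let Eabs k z D : 0 < k ->
  \int[kernel_prob M D]_y `|phi z y| <=
  (k * (\sum_j \sum_k (S j z * S k z) * G j k D) + k^-1) / 2.
Proof.
move=> k0.
have i1 : L1 (kernel_prob M D) (phi z) by exact: (L1_bounded _ (mphi z) (phib z)).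
have i2 : L1 (kernel_prob M D) (fun y => phi z y ^+ 2).
  apply: (L1_bounded _ (b := (b * \sum_j `|S j z|) ^+ 2)).
    exact: measurable_funX.
  by move=> y; rewrite normrX lerXn2r ?nnegrE ?(le_trans _ (phib z y)).
rewrite -Rint_phi2 -RintZl// -[X in _ + X](Rint_cst (kernel_prob M D)).
have i3 : L1 (kernel_prob M D) (fun=> k^-1) by exact: L1_cst.
rewrite -RintD; [|exact: L1Zl|exact: i3].
rewrite -RintZr; last by apply: L1D; [exact: L1Zl|exact: i3].
apply: le_Rint; first exact: L1_norm.
  by apply: L1Zr; apply: L1D; [exact: L1Zl|exact: i3].
move=> y; have := young `|phi z y| 1 k0.
by rewrite expr1n !mulr1 real_normK ?num_real.
Qed.

Let le_quad D : \int[P]_z (\sum_j \sum_k (S j z * S k z) * G j k D) <= lam * g D.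
Proof.
pose c j k := \int[P]_z (S j z * S k z).
have E1 : \int[P]_z (\sum_j \sum_k (S j z * S k z) * G j k D)
    = \sum_j \sum_k c j k * G j k D.
  rewrite Rint_sum; last by move=> j; apply: L1_sum => k; apply: L1Zr.
  apply: eq_bigr => j _; rewrite Rint_sum; last by move=> k; apply: L1Zr.
  by apply: eq_bigr => k _; rewrite RintZr.
have E2 : \sum_j \sum_k c j k * G j k D
    = \int[kernel_prob M D]_y (\sum_j \sum_k c j k * (v j y * v k y)).
  rewrite Rint_sum; last by move=> j; apply: L1_sum => k; apply: L1Zl.
  apply: eq_bigr => j _; rewrite Rint_sum; last by move=> k; apply: L1Zl.
  by apply: eq_bigr => k _; rewrite RintZl.
have L1v2 : L1 (kernel_prob M D) (fun y => \sum_j v j y ^+ 2).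
  apply: L1_sum => j.
  apply: (eq_integrable measurableT _ _ _ (L1_vv j j D)) => y _.
  by rewrite /= expr2.
rewrite E1 E2 /g -RintZl//.
apply: le_Rint; [|exact: L1Zl|].
  by apply: L1_sum => j; apply: L1_sum => k; apply: L1Zl.
move=> y; apply: le_trans (le_comb2 (fun j => v j y)).
rewrite le_eqVlt; apply/orP; left; apply/eqP.
rewrite -[RHS]/(\int[P]_z (phi z y ^+ 2)).
under [RHS]eq_Rintegral do rewrite phi2E.
rewrite Rint_sum; last by move=> j; apply: L1_sum => k; apply: L1Zr.
apply: eq_bigr => j _; rewrite Rint_sum; last by move=> k; apply: L1Zr.
by apply: eq_bigr => k _; rewrite RintZr.
Qed.

Hypothesis b_ge0 : 0 <= b.

(** Resample the i-th record, use privacy to return to the output computed from the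
original data set, and observe that this output does not involve the fresh
record z: the first-order term is centered, the absolute value is controlled by
the second moment, and the supremum of [phi z] is at most b sum_j |S_j(z)|. *)
Lemma attack_le_dp i (k : R) : 0 < k ->
  \int[Q]_D (\sum_j V j D * S j (tnth D i))
  <= (e - 1) * (k * (lam * \int[Q]_D g D) + k^-1) / 2
     + delta * b * d%:R * (lam + 1).
Proof.
move=> k0.
pose F (D : n.-tuple T) := \sum_j V j D * S j (tnth D i).
have E D z : F (tupd D i z) = \sum_j V j (tupd D i z) * S j z.
  by apply: eq_bigr => j _; rewrite tnth_tupd_id.
have iFz D : L1 P (fun z => F (tupd D i z)).
  rewrite (_ : (fun z => _) = (fun z => \sum_j V j (tupd D i z) * S j z)); last first.
    by apply/funext => z; exact: E.
  apply: L1_sum => j.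
  apply: (L1_le (g := fun z => b * `|S j z|)).
  - apply: measurable_funM => //.
    have mz : measurable_fun setT (fun z : T => (D, z)).
      exact: measurable_pair1.
    exact: (measurableT_comp (mV j) (measurableT_comp (measurable_tupd i) mz)).
  - by move=> z; rewrite normrM ler_wpM2r.
  - by apply: L1Zl; exact: L1_norm.
rewrite -[X in X <= _]/(\int[Q]_D F D).
rewrite (Rint_resample PQ (L1_attack i) iFz).
pose quad D z := \sum_j \sum_k (S j z * S k z) * G j k D.
have L1quad D : L1 P (quad D).
  by apply: L1_sum => j; apply: L1_sum => k'; apply: L1Zr.
have L1VS D : L1 P (fun z => \sum_j V j D * S j z).
  by apply: L1_sum => j; apply: L1Zl.
have L1aS : L1 P (fun z => \sum_j `|S j z|).
  by apply: L1_sum => j; exact: L1_norm.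
(* the bound given by privacy for a fixed data set D and a fresh record z *)
pose B D z := \sum_j V j D * S j z
  + (e - 1) * ((k * quad D z + k^-1) / 2) + 2 * delta * (b * \sum_j `|S j z|).
have L1q D : L1 P (fun z => (k * quad D z + k^-1) / 2).
  by apply: L1Zr; apply: L1D; [apply: L1Zl|exact: L1_cst].
have L1B D : L1 P (B D).
  apply: L1D; first by apply: L1D => //; apply: L1Zl; exact: L1q.
  by apply: L1Zl; apply: L1Zl.
have FB D z : F (tupd D i z) <= B D z.
  rewrite E -RintV.
  apply: le_trans (dp_expectation (mu' := kernel_prob M D) (e := e)
    (delta := delta) _ _ _ _ (mphi z) (phib z)) _ => //.
  - by move=> A mA; case: (dpM D i z mA).
  - by move=> A mA; case: (dpM D i z mA).
  rewrite /B RintV lerD2r lerD2l ler_wpM2l ?subr_ge0//.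
  exact: Eabs.
have e10 : 0 <= e - 1 by rewrite subr_ge0.
pose c := (e - 1) * k^-1 / 2 + delta * b * d%:R * (lam + 1).
apply: (@le_trans _ _ (\int[Q]_D ((e - 1) * (k * lam) / 2 * g D + c))).
  apply: le_Rint.
  - exact: (L1_resample_int PQ (L1_attack i) iFz).
  - by apply: L1D; [exact: L1Zl|exact: L1_cst].
  move=> D; apply: (@le_trans _ _ (\int[P]_z B D z)).
    exact: (le_Rint (iFz D) (L1B D) (FB D)).
  rewrite RintD; [|by apply: L1D => //; apply: L1Zl; exact: L1q|by apply: L1Zl; apply: L1Zl].
  rewrite RintD//; last by apply: L1Zl; exact: L1q.
  rewrite Rint_sum; last by move=> j; apply: L1Zl.
  rewrite big1 ?add0r; last by move=> j _; rewrite RintZl// S_mean mulr0.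
  rewrite RintZl; last exact: L1q.
  rewrite RintZr; last by apply: L1D; [apply: L1Zl|exact: L1_cst].
  rewrite RintD; [|exact: L1Zl|exact: L1_cst].
  rewrite Rint_cst RintZl// !RintZl//; last exact: L1Zl.
  have h1 : \int[P]_z quad D z <= lam * g D by exact: le_quad.
  have h2 : \int[P]_z (\sum_j `|S j z|) <= d%:R * ((lam + 1) / 2).
    rewrite Rint_sum; last by move=> j; exact: L1_norm.
    rewrite -[X in X%:R](card_ord d) mulr_natl -sumr_const.
    by apply: ler_sum => j _; exact: le_absS.
  have h3 : k * \int[P]_z quad D z <= k * (lam * g D) by rewrite ler_wpM2l// ltW.
  have h4 : (e - 1) * (k * \int[P]_z quad D z) <= (e - 1) * (k * (lam * g D)).
    by rewrite ler_wpM2l.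
  have h5 : delta * b * (\int[P]_z (\sum_j `|S j z|))
      <= delta * b * (d%:R * ((lam + 1) / 2)).
    by rewrite ler_wpM2l// mulr_ge0.
  rewrite /c; lra.
rewrite RintD; [|exact: L1Zl|exact: L1_cst].
rewrite Rint_cst RintZl// /c; lra.
Qed.

End attack.

(** * One-dimensional calculus and the uniform law *)

Section derivative_rules.
Context {R : realType}.
Implicit Types (f g : R -> R) (t a b c : R).

Lemma derD f g t a b : is_derive t 1 f a -> is_derive t 1 g b ->
  is_derive t 1 (fun x => f x + g x) (a + b).
Proof. by move=> ? ?; exact: (is_deriveD (f := f) (g := g)). Qed.

Lemma derB f g t a b : is_derive t 1 f a -> is_derive t 1 g b ->
  is_derive t 1 (fun x => f x - g x) (a - b).
Proof. by move=> ? ?; exact: (is_deriveB (f := f) (g := g)). Qed.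

Lemma derM f g t a b : is_derive t 1 f a -> is_derive t 1 g b ->
  is_derive t 1 (fun x => f x * g x) (a * g t + f t * b).
Proof.
move=> ? ?; apply: (is_derive_eq (is_deriveM (f := f) (g := g) _ _)).
by rewrite /GRing.scale /= addrC mulrC.
Qed.

Lemma der_cst c t : is_derive t 1 (fun=> c) (0 : R).
Proof. exact: is_derive_cst. Qed.

Lemma der_id t : is_derive t 1 (fun x : R => x) (1 : R).
Proof. exact: is_derive_id. Qed.

Lemma der_comp f g t a b : is_derive t 1 g b -> is_derive (g t) 1 f a ->
  is_derive t 1 (fun x => f (g x)) (a * b).
Proof. by move=> ? ?; exact: (is_derive1_comp (f := f) (g := g)). Qed.

Lemma der_sum (n : nat) (f : 'I_n -> R -> R) (a : 'I_n -> R) t :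
  (forall i, is_derive t 1 (f i) (a i)) ->
  is_derive t 1 (fun x => \sum_(i < n) f i x) (\sum_(i < n) a i).
Proof.
move=> h; rewrite (_ : (fun x => _) = \sum_(i < n) f i); first exact: is_derive_sum.
by apply/funext => x; rewrite fct_sumE.
Qed.

Lemma der_continuous f t a : is_derive t 1 f a -> {for t, continuous f}.
Proof. by move=> [h _]; apply: differentiable_continuous; exact/derivable1_diffP. Qed.

End derivative_rules.

Section uniform_FTC.
Context {R : realType} (a : R) (a_gt0 : 0 < a).

Let NaLa : - a < a. Proof. by rewrite gtrN. Qed.

Let idTR : measurableTypeR R -> R := idfun.

#[local] HB.instance Definition _ :=
  @isMeasurableFun.Build _ _ _ _ idTR (@measurable_id _ _ setT).

Let unif0 : probability (measurableTypeR R) R := uniform_prob NaLa.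

(** [uniform_prob] lives on the measurable type of the Lebesgue measure, whose
display is not that of [R]; hence the transport along the identity. *)
Definition unif : probability R R := distribution unif0 idTR.

(** [h] need only agree with the derivative [k] on [-a, a]: in the applications it
is precomposed with the projection to this interval. *)
Lemma unif_FTC (h k F : R -> R) :
  measurable_fun setT h -> continuous k ->
  (forall t : R, is_derive t 1 F (k t)) ->
  (forall t, - a <= t <= a -> h t = k t) ->
  L1 unif h /\ \int[unif]_t h t = (F a - F (- a)) / (2 * a).
Proof.
move=> mh ck Fk hk.
have mk : measurable_fun setT k by exact: continuous_measurable_fun.
have mf := @measurable_uniform_pdf R (- a) a.
have f0 (x : R) : 0 <= uniform_pdf (- a) a x by exact: uniform_pdf_ge0.
have PE A : measurable A ->
    unif0 A = (\int[lebesgue_measure]_x (\1_A x * uniform_pdf (- a) a x)%:E)%E.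
  move=> mA; rewrite -[LHS]/(\int[lebesgue_measure]_(x in A) (uniform_pdf (- a) a x)%:E)%E.
  rewrite integral_mkcond; apply: eq_integral => x _.
  rewrite patchE indicE; case: ifP => _; first by rewrite mul1r.
  by rewrite mul0r.
have iab : lebesgue_measure.-integrable `[- a, a] (EFin \o k).
  apply: continuous_compact_integrable; first exact: segment_compact.
  exact: continuous_subspaceT.
have E x : (h x * uniform_pdf (- a) a x)%:E
    = (((EFin \o (fun t => k t * (2 * a)^-1)%R) \_ `[- a, a]) x).
  rewrite patchE /uniform_pdf; case: ifPn => [xab|xab].
    rewrite mem_set ?hk//=.
    by congr (_ * _^-1)%:E; lra.
  by rewrite memNset ?mulr0//=; apply/negP.
have L1lh : L1 lebesgue_measure (fun x => h x * uniform_pdf (- a) a x).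
  rewrite /L1 (_ : EFin \o _ = (EFin \o (fun t => k t * (2 * a)^-1)%R) \_ `[- a, a]);
    last by apply/funext => x; rewrite /= E.
  apply/(integrable_mkcond _ _).1 => //.
  apply: (eq_integrable _ _ _ _ (integrableZr _ (2 * a)^-1 iab)) => //.
have mf' : measurable_fun [set: measurableTypeR R] (uniform_pdf (- a) a) := mf.
have mh' : measurable_fun [set: measurableTypeR R] h := mh.
have L1h : L1 unif0 h by exact: ((L1_density mf' f0 PE mh').2 L1lh).
have mhE : measurable_fun setT (EFin \o h) by exact/measurable_EFinP.
split; first exact: (integrable_pushforward (phi := idTR) _ mhE L1h).
transitivity (\int[unif0]_t h t).
  congr fine; exact: (integral_pushforward (phi := idTR) _ mhE L1h).
rewrite (Rint_density mf' f0 PE L1h) /Rintegral.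
under eq_integral do rewrite E.
rewrite -integral_mkcond.
rewrite -[LHS]/(\int[lebesgue_measure]_(t in `[- a, a]) (k t * (2 * a)^-1)).
rewrite RintegralZr//; congr (_ * _); rewrite /Rintegral.
rewrite (@continuous_FTC2 _ k F)//.
- exact: continuous_subspaceT.
- split.
  + by move=> x _; case: (Fk x).
  + exact: cvg_at_right_filter (der_continuous (Fk (- a))).
  + exact: cvg_at_left_filter (der_continuous (Fk a)).
- by move=> x _; rewrite derive1E; case: (Fk x).
Qed.

End uniform_FTC.

(** * Integration by parts over the uniform prior *)

Section clamp.
Context {R : realType}.
Implicit Types a s t : R.

Definition clamp a t : R := Num.max (- a) (Num.min t a).

Lemma clamp_norm a t : 0 <= a -> `|clamp a t| <= a.
Proof.
move=> a0; rewrite ler_norml /clamp le_max lexx/= ge_max ge_min lexx orbT andbT.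
by lra.
Qed.

Lemma clamp_id a t : - a <= t <= a -> clamp a t = t.
Proof. by move=> /andP[h1 h2]; rewrite /clamp (min_idPl h2) (max_idPr h1). Qed.

Lemma clamp_dist a t s : - a <= s <= a -> `|clamp a t - s| <= `|t - s|.
Proof.
move=> /andP[h1 h2]; rewrite /clamp.
have [ta|ta] := leP t a.
  have [at'|at'] := leP (- a) t; first by [].
  by rewrite !ler0_norm; lra.
have -> : Num.max (- a) a = a by apply/max_idPr; lra.
by rewrite !ger0_norm; lra.
Qed.

Definition clampv a (d : nat) (b : d.-tuple R) : d.-tuple R :=
  [tuple clamp a (tnth b i) | i < d].

Lemma tnth_clampv a d (b : d.-tuple R) i : tnth (clampv a b) i = clamp a (tnth b i).
Proof. by rewrite tnth_mktuple. Qed.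

Lemma clampv_tupd a d (b : d.-tuple R) i t :
  clampv a (tupd b i t) = tupd (clampv a b) i (clamp a t).
Proof.
by apply: eq_from_tnth => j; rewrite !(tnth_clampv, tnth_tupd); case: eqP.
Qed.

Lemma measurable_clamp a : measurable_fun setT (clamp a).
Proof.
apply: measurable_maxr; first exact: measurable_cst.
by apply: measurable_minr => //; exact: measurable_cst.
Qed.

Lemma measurable_clampv a d : measurable_fun setT (@clampv a d).
Proof.
apply/measurable_fun_tnthP => i.
rewrite (_ : _ \o _ = clamp a \o (fun b : d.-tuple R => tnth b i)); last first.
  by apply/funext => b /=; rewrite tnth_clampv.
by apply: (measurableT_comp (measurable_clamp a)); exact: measurable_tnth.
Qed.

End clamp.

Section stein.
Context {R : realType} {dO : measure_display} {O : measurableType dO} {d : nat}.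
Variables (a : R) (Q0 : probability O R).
Hypothesis a_gt0 : 0 < a.
Variables (p : d.-tuple R -> O -> R) (s : 'I_d -> d.-tuple R -> O -> R)
  (m : 'I_d -> O -> R) (B : R).
Hypothesis p_ge0 : forall b D, 0 <= p b D.
Hypothesis mp : measurable_fun setT (fun u : d.-tuple R * O => p u.1 u.2).
Hypothesis ms : forall j,
  measurable_fun setT (fun u : d.-tuple R * O => s j u.1 u.2).
Hypothesis mm : forall j, measurable_fun setT (m j).
Hypothesis m_le : forall j D, `|m j D| <= a.
Hypothesis p_der : forall b D j (t : R),
  is_derive t 1 (fun x => p (tupd b j x) D)
    (s j (tupd b j t) D * p (tupd b j t) D).
Hypothesis s_cont : forall b D j, continuous (fun x : R => s j (tupd b j x) D).
Hypothesis p_int : forall b, (\int[Q0]_D (p b D)%:E = 1)%E.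
Hypothesis s_int : forall b j, (\int[Q0]_D (`|s j b D| * p b D)%:E <= B%:E)%E.

(** The weight vanishes at -a and a, so that the integrations by parts have no
boundary term. *)
Definition bump (t : R) : R := 1 - (t / a) ^+ 2.
Definition bump' (t : R) : R := - (2 * t / a ^+ 2).

Lemma der_bump (t : R) : is_derive t 1 bump (bump' t).
Proof.
have a0 : a != 0 by rewrite gt_eqF.
have h : is_derive t 1 (fun x : R => x / a) (1 * a^-1 + t * 0).
  exact: (derM (der_id t) (der_cst _ t)).
apply: (is_derive_eq (derB (der_cst 1 t) (derM h h))).
by rewrite /bump'; field.
Qed.

Let cbump : continuous bump.
Proof. by move=> t; exact: der_continuous (der_bump t). Qed.

Let cbump' : continuous bump'.
Proof.
move=> t; apply: cvgN; apply: cvgM; last exact: cvg_cst.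
by apply: cvgM; [exact: cvg_cst|exact: cvg_id].
Qed.

Let mbump : measurable_fun setT bump.
Proof. exact: continuous_measurable_fun. Qed.

Let mbump' : measurable_fun setT bump'.
Proof. exact: continuous_measurable_fun. Qed.

(** This is the derivative in b_j of [bump b_j * (m j D - b_j) * p b D] when
[s j b D] is the logarithmic derivative of the likelihood [p]. *)
Definition stein_kernel j b D : R :=
  (bump' (tnth b j) * (m j D - tnth b j) - bump (tnth b j)
   + bump (tnth b j) * (m j D - tnth b j) * s j b D) * p b D.

(* clamping the parameter makes all the bounds global *)
Let K j b D := stein_kernel j (clampv a b) D.

Lemma bump_01 (x : R) : `|x| <= a -> 0 <= bump x <= 1.
Proof.
move=> xa; rewrite /bump lerBlDr lerDl sqr_ge0 andbT subr_ge0.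
rewrite -(real_normK (num_real (x / a))) expr_le1// normrM normfV (gtr0_norm a_gt0).
by rewrite ler_pdivrMr// mul1r.
Qed.

Lemma bump'_le (x : R) : `|x| <= a -> `|bump' x| <= 2 / a.
Proof.
move=> xa; rewrite /bump' normrN normrM normfV normrM ger0_norm//.
rewrite (ger0_norm (sqr_ge0 a)) -mulrA ler_wpM2l// ler_pdivrMr ?exprn_gt0//.
by rewrite expr2 mulrA mulVf ?mul1r// gt_eqF.
Qed.

Lemma stein_kernel_le j b D : (forall i, `|tnth b i| <= a) ->
  `|stein_kernel j b D| <= 5 * p b D + 2 * a * (`|s j b D| * p b D).
Proof.
move=> ba; rewrite /stein_kernel normrM (ger0_norm (p_ge0 _ _)).
rewrite [X in _ <= X](_ : _ = (5 + 2 * a * `|s j b D|) * p b D); last by ring.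
rewrite ler_wpM2r//.
have /andP[w0 w1] := bump_01 (ba j); have w' := bump'_le (ba j).
have mb : `|m j D - tnth b j| <= 2 * a.
  by apply: le_trans (ler_normB _ _) _; have := m_le j D; have := ba j; lra.
apply: le_trans (ler_normD _ _) _; apply: lerD; last first.
  rewrite !normrM (ger0_norm w0) ler_wpM2r//.
  by rewrite -[X in _ <= X]mul1r ler_pM.
apply: le_trans (ler_normB _ _) _.
rewrite (_ : 5 = 2 / a * (2 * a) + 1); last by field; rewrite gt_eqF.
by apply: lerD; [rewrite normrM ler_pM|rewrite ger0_norm].
Qed.

Let mK j : measurable_fun setT (fun u : d.-tuple R * O => K j u.1 u.2).
Proof.
have m1 : measurable_fun setT
    (fun u : d.-tuple R * O => (clampv a u.1, u.2)).
  apply/measurable_fun_pairP; split; last exact: measurable_snd.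
  exact: (measurableT_comp (@measurable_clampv _ a d) measurable_fst).
have mt : measurable_fun setT (fun u : d.-tuple R * O => tnth (clampv a u.1) j).
  apply: (measurableT_comp (measurable_tnth j)).
  exact: (measurableT_comp (@measurable_clampv _ a d) measurable_fst).
have mmj : measurable_fun setT (fun u : d.-tuple R * O => m j u.2).
  exact: (measurableT_comp (mm j) measurable_snd).
have mb : measurable_fun setT (fun u : d.-tuple R * O => bump (tnth (clampv a u.1) j)).
  exact: (measurableT_comp mbump mt).
have mb' : measurable_fun setT (fun u : d.-tuple R * O => bump' (tnth (clampv a u.1) j)).
  exact: (measurableT_comp mbump' mt).
apply: measurable_funM; last exact: (measurableT_comp mp m1).
apply: measurable_funD.
  by apply: measurable_funB => //; apply: measurable_funM => //; exact: measurable_funB.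
apply: measurable_funM; last exact: (measurableT_comp (ms j) m1).
by apply: measurable_funM => //; exact: measurable_funB.
Qed.

Let clampv_le (b : d.-tuple R) i : `|tnth (clampv a b) i| <= a.
Proof. by rewrite tnth_clampv clamp_norm// ltW. Qed.

Let mp1 b : measurable_fun setT (p b).
Proof. exact: (measurableT_comp mp (measurable_pair1 b)). Qed.

Let ms1 j b : measurable_fun setT (s j b).
Proof. exact: (measurableT_comp (ms j) (measurable_pair1 b)). Qed.

Let int_normK j b : (\int[Q0]_D `|(K j b D)%:E| <= (5 + 2 * a * B)%:E)%E.
Proof.
have m1 : measurable_fun setT (fun D => (5 * p (clampv a b) D)%:E).
  by apply/measurable_EFinP; apply: measurable_funM => //; exact: measurable_cst.
have m2 : measurable_fun setT (fun D => (`|s j (clampv a b) D| * p (clampv a b) D)%:E).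
  apply/measurable_EFinP; apply: measurable_funM => //.
  exact: measurableT_comp.
apply: (@le_trans _ _ (\int[Q0]_D ((5 * p (clampv a b) D)%:E
    + (2 * a)%:E * (`|s j (clampv a b) D| * p (clampv a b) D)%:E))%E).
  apply: ge0_le_integral => //.
  - apply: measurableT_comp => //; apply/measurable_EFinP.
    exact: (measurableT_comp (mK j) (measurable_pair1 b)).
  - by apply: emeasurable_funD => //; exact: measurable_funeM.
  - move=> D _; rewrite -EFinM -EFinD lee_fin; exact: stein_kernel_le.
have a0 : 0 <= 2 * a by rewrite mulr_ge0// ltW.
rewrite ge0_integralD//; first last.
- exact: measurable_funeM.
- by move=> D _; rewrite -EFinM lee_fin; do 2 apply: mulr_ge0 => //.
- by move=> D _; rewrite lee_fin mulr_ge0.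
under eq_integral do rewrite EFinM.
rewrite ge0_integralZl//; first last.
- by move=> D _; rewrite lee_fin.
- by apply/measurable_EFinP.
rewrite p_int mule1 ge0_integralZl//; last first.
  by move=> D _; rewrite lee_fin mulr_ge0.
by rewrite [X in (_ <= X)%E]EFinD leeD2l// [X in (_ <= X)%E]EFinM lee_wpmul2l.
Qed.

Variable pi : probability (d.-tuple R) R.
Hypothesis pi_iid : iid_law (unif a_gt0) pi.

Let L1K j : L1 (pi \x Q0)%E (fun u => K j u.1 u.2).
Proof.
apply/integrable12ltyP; first exact/measurable_EFinP.
apply: (@le_lt_trans _ _ (\int[pi]_b (5 + 2 * a * B)%:E)%E).
  apply: ge0_le_integral => //.
  - by move=> b _; apply: integral_ge0 => D _; exact: abse_ge0.
  - have mf : measurable_fun setT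
        (fun u : d.-tuple R * O => `|(K j u.1 u.2)%:E|%E).
      by apply: measurableT_comp => //; exact/measurable_EFinP.
    have f0 (u : d.-tuple R * O) : (0 <= `|(K j u.1 u.2)%:E|)%E by [].
    have := @measurable_fun_fubini_tonelli_F _ _ _ _ R Q0 _ mf f0.
    exact.
  - by move=> b _; exact: int_normK.
rewrite integral_cst// [X in (_ * X)%E]probability_setT mule1 ltry//.
Qed.

(** For a fixed data set the kernel is an exact derivative along the j-th
coordinate, of a function that vanishes at both ends of the interval. *)
Let line j b D :
  L1 (unif a_gt0) (fun t => K j (tupd b j t) D) /\
  \int[unif a_gt0]_t K j (tupd b j t) D = 0.
Proof.
pose c := clampv a b.
pose F t := bump t * (m j D - t) * p (tupd c j t) D.
pose k t := stein_kernel j (tupd c j t) D.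
have kE t : k t = (bump' t * (m j D - t) - bump t
   + bump t * (m j D - t) * s j (tupd c j t) D) * p (tupd c j t) D.
  by rewrite /k /stein_kernel tnth_tupd_id.
have Fk (t : R) : is_derive t 1 F (k t).
  have h1 : is_derive t 1 (fun x => m j D - x) (0 - 1).
    exact: (derB (der_cst _ t) (der_id t)).
  apply: (is_derive_eq (derM (derM (der_bump t) h1) (p_der c D j t))).
  rewrite kE; ring.
have ck : continuous k.
  move=> t; rewrite (_ : k = fun t => (bump' t * (m j D - t) - bump t
   + bump t * (m j D - t) * s j (tupd c j t) D) * p (tupd c j t) D); last first.
    by apply/funext => x; rewrite kE.
  have cm : {for t, continuous (fun x => m j D - x)}.
    by apply: cvgB; [exact: cvg_cst|exact: cvg_id].
  apply: cvgM; last exact: der_continuous (p_der c D j t).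
  apply: cvgD.
    by apply: cvgB; [apply: cvgM; [exact: cbump'|exact: cm]|exact: cbump].
  by apply: cvgM; [apply: cvgM; [exact: cbump|exact: cm]|exact: s_cont].
have mh : measurable_fun setT (fun t => K j (tupd b j t) D).
  have m1 : measurable_fun setT (fun t : R => (b, t)) by exact: measurable_pair1.
  have m2 : measurable_fun setT (fun t : R => (tupd b j t, D)).
    apply/measurable_fun_pairP; split.
      exact: (measurableT_comp (measurable_tupd j) m1).
    exact: measurable_cst.
  exact: (measurableT_comp (mK j) m2).
have := @unif_FTC R a a_gt0 _ k F mh ck Fk.
case.
  by move=> t ta; rewrite /K clampv_tupd clamp_id.
move=> h ->; split=> //.
rewrite /F /bump mulNr divff ?gt_eqF// sqrrN expr1n subrr !mul0r subrr.
by rewrite mul0r.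
Qed.

Let int_bump : L1 (unif a_gt0) (fun t => bump (clamp a t)) /\
  \int[unif a_gt0]_t bump (clamp a t) = 2 / 3.
Proof.
pose F (t : R) := t - (t * t * t) / (3 * a ^+ 2).
have Fk (t : R) : is_derive t 1 F (bump t).
  have i := @der_id R t.
  apply: (is_derive_eq (derB i (derM (derM (derM i i) i) (der_cst (3 * a ^+ 2)^-1 t)))).
  by rewrite /bump; field; rewrite gt_eqF.
have mh : measurable_fun setT (fun t : R => bump (clamp a t)).
  exact: (measurableT_comp mbump (measurable_clamp a)).
have hk (t : R) : - a <= t <= a -> bump (clamp a t) = bump t.
  by move=> ta; rewrite clamp_id.
have [h ->] := @unif_FTC R a a_gt0 _ bump F mh cbump Fk hk.
by split=> //; rewrite /F; field; rewrite gt_eqF.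
Qed.

Lemma L1_stein_kernel j b : (forall i, `|tnth b i| <= a) ->
  L1 Q0 (stein_kernel j b).
Proof.
move=> ba.
have E : clampv a b = b.
  by apply: eq_from_tnth => i; rewrite tnth_clampv clamp_id// -ler_norml.
have mKb : measurable_fun setT (K j b).
  exact: (measurableT_comp (mK j) (measurable_pair1 b)).
have -> : stein_kernel j b = K j b by rewrite /K E.
apply/integrableP; split; first exact/measurable_EFinP.
by apply: le_lt_trans (int_normK j b) _; rewrite ltry.
Qed.

(** Fubini, then resampling of the j-th coordinate of the prior, which reduces to
[line].  The kernel is known to be integrable in the parameter for almost every
data set only. *)
Let int0 j : (\int[pi]_b \int[Q0]_D (K j b D)%:E = 0)%E.
Proof.
pose f (u : d.-tuple R * O) := (K j u.1 u.2)%:E.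
have i : (pi \x Q0)%E.-integrable setT f by exact: (L1K j).
rewrite (integral12_prod_meas1 i) -(integral21_prod_meas1 i).
rewrite (@ae_eq_integral _ _ _ _ setT (cst 0%E))//.
- by rewrite integral0.
- exact: measurable_fubini_G i.
have := ae_integrable2 i; apply: filterS => D iD _.
have L1D' : L1 pi (fun b => K j b D) by exact: iD.
rewrite /fubini_G -[LHS]/(\int[pi]_b (K j b D)%:E)%E -EFin_Rint//.
rewrite (Rint_resample (i := j) pi_iid L1D'); last by move=> b; case: (line j b D).
rewrite (@eq_Rintegral _ _ _ _ _ (fun=> 0)); last by move=> b _; case: (line j b D).
by rewrite Rint_cst.
Qed.

(** The constant 2 / 3 is the mean of the bump over the uniform law. *)
Lemma stein_bound (u : R) :
  (forall b, (forall i, `|tnth b i| <= a) ->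
    \sum_j \int[Q0]_D stein_kernel j b D <= u - \sum_j bump (tnth b j)) ->
  2 / 3 * d%:R <= u.
Proof.
move=> H.
have LQ j b : L1 Q0 (K j b) by apply: L1_stein_kernel.
have L1i j : L1 pi (fun b => \int[Q0]_D K j b D).
  have := integrable_fubini_F (L1K j).
  apply: (eq_integrable measurableT) => b _.
  by rewrite /fubini_F /= -EFin_Rint.
have i0 j : \int[pi]_b \int[Q0]_D K j b D = 0.
  apply/EFin_inj; rewrite EFin_Rint// -[RHS](int0 j).
  by apply: eq_integral => b _; rewrite -EFin_Rint.
have L1b j : L1 pi (fun b => bump (clamp a (tnth b j))).
  exact: (L1_marginal pi_iid j int_bump.1).
have ib j : \int[pi]_b bump (clamp a (tnth b j)) = 2 / 3.
  by rewrite (Rint_marginal pi_iid j int_bump.1) int_bump.2.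
have : \int[pi]_b (\sum_j \int[Q0]_D K j b D) <=
    \int[pi]_b (u - \sum_j bump (clamp a (tnth b j))).
  apply: le_Rint.
  - exact: L1_sum.
  - by apply: L1B; [exact: L1_cst|exact: L1_sum].
  - move=> b; have := H (clampv a b) (clampv_le b).
    by under [X in _ <= _ - X -> _]eq_bigr do rewrite tnth_clampv.
rewrite Rint_sum// RintB; [|exact: L1_cst|exact: L1_sum].
rewrite Rint_cst Rint_sum// big1; last by move=> j _; exact: i0.
under eq_bigr do rewrite ib.
by rewrite sumr_const card_ord subr_ge0 -[X in X <= _]mulr_natr.
Qed.

End stein.

(** * Moments of the residual of an exponential family *)

Section taylor.
Context {R : realType} (psi : R -> R) (c2 : R).
Hypothesis d1 : forall t : R, derivable psi t 1.
Hypothesis d2 : forall t : R, derivable (psi^`())%classic t 1.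
Hypothesis psi2 : forall t : R, `|(psi^`(2))%classic t| <= c2.

Local Notation psi' := (psi^`())%classic.

Lemma der_psi (t : R) : is_derive t 1 psi (psi' t).
Proof. by split; [exact: d1|rewrite derive1E]. Qed.

Lemma der_psi' (t : R) : is_derive t 1 psi' ((psi^`(2))%classic t).
Proof. by split; [exact: d2|rewrite -derive1E]. Qed.

Let mvt (f f' : R -> R) (a b : R) : (forall t : R, is_derive t 1 f (f' t)) ->
  exists2 c, `|c - a| <= `|b - a| & f b - f a = f' c * (b - a).
Proof.
move=> ff'; have cf : continuous f by move=> t; exact: der_continuous (ff' t).
have [ab|/ltW ba] := leP a b.
  have [c] := MVT_segment ab (fun x _ => ff' x) (continuous_subspaceT cf).
  rewrite in_itv/= => /andP[h1 h2] E; exists c => //.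
  by rewrite !ger0_norm ?subr_ge0// lerD2r.
have [c] := MVT_segment ba (fun x _ => ff' x) (continuous_subspaceT cf).
rewrite in_itv/= => /andP[h1 h2] E; exists c; last by rewrite -opprB E; ring.
by rewrite !ler0_norm ?subr_le0// lerN2 lerD2r.
Qed.

(** Two applications of the mean value theorem; the constant 1/2 of Taylor's formula
is lost, which is harmless. *)
Lemma psi_taylor (t u : R) : psi (t + u) - psi t - u * psi' t <= c2 * u ^+ 2.
Proof.
have [c hc ->] := @mvt psi psi' t (t + u) der_psi.
have [e he E] := @mvt psi' _ t c der_psi'.
rewrite addrAC subrr add0r in hc *.
rewrite (_ : _ - _ = (psi' c - psi' t) * u); last by ring.
rewrite E; apply: le_trans (ler_norm _) _.
rewrite !normrM -(real_normK (num_real u)) expr2 mulrA ler_wpM2r//.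
by rewrite ler_pM.
Qed.

End taylor.

Section exponential_inequalities.
Context {R : realType}.
Implicit Types x : R.

(** exp y is the square of exp (y/2), which is at least y/2 for y >= 0. *)
Lemma sqr_le_expRN x : x ^+ 2 <= 4 * (expR x + expR (- x)).
Proof.
have h (y : R) : 0 <= y -> y ^+ 2 <= 4 * expR y.
  move=> y0; have E : expR y = expR (y / 2) ^+ 2 by rewrite -expRM_natr divfK.
  have h1 : y / 2 <= expR (y / 2) by apply: le_trans (expR_ge1Dx _); rewrite lerDr.
  have h2 : 0 <= y / 2 by rewrite divr_ge0.
  by rewrite E; nra.
have [x0|x0] := leP 0 x.
  by have := h x x0; have := expR_ge0 (- x); lra.
have /h : 0 <= - x by rewrite oppr_ge0 ltW.
by rewrite sqrrN; have := expR_ge0 x; lra.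
Qed.

Lemma expRB1_le x : expR x - 1 <= x * expR x.
Proof.
have h := expR_ge1Dx (- x).
have E : expR (- x) * expR x = 1 by rewrite mulrC expRxMexpNx_1.
have : (1 - x) * expR x <= 1 by rewrite -[leRHS]E ler_wpM2r ?expR_ge0.
by lra.
Qed.

End exponential_inequalities.

Section subgaussian_moments.
Context {disp : measure_display} {T : measurableType disp} {R : realType}.
Variables (m : {measure set T -> \bar R}) (f z : T -> R) (s : R).
Hypothesis mf : measurable_fun setT f.
Hypothesis f0 : forall y, 0 <= f y.
Hypothesis f1 : (\int[m]_y (f y)%:E = 1)%E.
Hypothesis mz : measurable_fun setT z.
Hypothesis s0 : 0 < s.
Hypothesis mgf : forall u : R,
  (\int[m]_y (expR (u * z y) * f y)%:E <= (expR (s * u ^+ 2))%:E)%E.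

Let mexp (u : R) : measurable_fun setT (fun y => expR (u * z y)).
Proof.
apply: (measurableT_comp (@measurable_expR R)); apply: measurable_funM => //.
Qed.

Let L1e (u : R) : L1 m (fun y => expR (u * z y) * f y).
Proof.
apply: L1_ge0_lty; first exact: measurable_funM.
  by move=> y; rewrite mulr_ge0 ?expR_ge0.
by apply: le_lt_trans (mgf u) _; rewrite ltry.
Qed.

Let Ie (u : R) : \int[m]_y (expR (u * z y) * f y) <= expR (s * u ^+ 2).
Proof. by rewrite -lee_fin EFin_Rint. Qed.

Let L1f : L1 m f.
Proof. by apply: L1_ge0_lty => //; rewrite f1 ltry. Qed.

Let If : \int[m]_y f y = 1.
Proof. by rewrite /Rintegral f1. Qed.

(* the value of u for which the bound exp(s u^2) is the constant e *)
Let u0 := Num.sqrt s^-1.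

Let u02 : u0 ^+ 2 = s^-1.
Proof. by rewrite sqr_sqrtr// invr_ge0 ltW. Qed.

Let z2_le y : z y ^+ 2 * f y <=
  s * (4 * (expR (u0 * z y) * f y + expR (- u0 * z y) * f y)).
Proof.
rewrite -mulrDl !mulrA ler_wpM2r//.
have := sqr_le_expRN (u0 * z y); rewrite exprMn u02 mulNr.
move=> /(ler_wpM2l (ltW s0)); rewrite (_ : s * (s^-1 * _) = z y ^+ 2); last first.
  by field; rewrite gt_eqF.
by rewrite mulrA.
Qed.

Let L1rhs : L1 m (fun y => s * (4 * (expR (u0 * z y) * f y + expR (- u0 * z y) * f y))).
Proof. by apply: L1Zl; apply: L1Zl; apply: L1D; exact: L1e. Qed.

Lemma L1_sub2 : L1 m (fun y => z y ^+ 2 * f y).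
Proof.
apply: L1_le L1rhs.
  by apply: measurable_funM => //; exact: measurable_funX.
by move=> y; rewrite ger0_norm ?z2_le// mulr_ge0// sqr_ge0.
Qed.

(** Integrate (u z)^2 <= 4 (exp(u z) + exp(- u z)) at u = 1 / sqrt s. *)
Lemma Rint_sub2_le : \int[m]_y (z y ^+ 2 * f y) <= 8 * expR 1 * s.
Proof.
apply: le_trans (le_Rint L1_sub2 L1rhs z2_le) _.
have L1a := L1D (L1e u0) (L1e (- u0)).
rewrite RintZl; last exact: L1Zl.
rewrite RintZl// RintD//.
have h1 := Ie u0; have := Ie (- u0); rewrite sqrrN u02 divff ?gt_eqF// => h2.
rewrite u02 divff ?gt_eqF// in h1.
rewrite [leRHS]mulrC ler_wpM2l ?(ltW s0)//; lra.
Qed.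

Lemma L1_sub1 : L1 m (fun y => z y * f y).
Proof.
apply: (L1_le (g := fun y => z y ^+ 2 * f y + f y)).
- exact: measurable_funM.
- move=> y; rewrite normrM (ger0_norm (f0 y)) -[X in _ + X]mul1r -mulrDl ler_wpM2r//.
  rewrite -(real_normK (num_real (z y))).
  by have := sqr_ge0 (`|z y| - 1); have := normr_ge0 (z y); nra.
- by apply: L1D L1f; exact: L1_sub2.
Qed.

Let Iz_le (u : R) : u * \int[m]_y (z y * f y) <= expR (s * u ^+ 2) - 1.
Proof.
rewrite -RintZl; last exact: L1_sub1.
apply: (@le_trans _ _ (\int[m]_y (expR (u * z y) * f y - f y))).
  apply: le_Rint.
  - by apply: L1Zl; exact: L1_sub1.
  - by apply: L1B.
  - move=> y; rewrite mulrA -[X in _ - X]mul1r -mulrBl ler_wpM2r//.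
    by have := expR_ge1Dx (u * z y); lra.
by rewrite RintB// If lerD2r.
Qed.

(** From u z <= exp(u z) - 1, used at u and at - u: the mean of z is O(u) for every
small u, hence zero. *)
Let Iz_small (u : R) : 0 < u <= 1 -> `|\int[m]_y (z y * f y)| <= s * expR s * u.
Proof.
move=> /andP[u_0 u_1].
set A := \int[m]_y _.
have h1 := Iz_le u; have h2 := Iz_le (- u); rewrite sqrrN -/A in h1 h2.
have h3 : expR (s * u ^+ 2) - 1 <= s * u ^+ 2 * expR s.
  apply: le_trans (expRB1_le _) _; rewrite ler_wpM2l//.
    by rewrite mulr_ge0 ?sqr_ge0// ltW.
  by rewrite ler_expR ger_pMr// expr_le1// ltW.
have E : s * u ^+ 2 * expR s = u * (s * expR s * u) by ring.
rewrite E in h3.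
rewrite ler_norml; apply/andP; split; rewrite -(ler_pM2l u_0); lra.
Qed.

Lemma Rint_sub1 : \int[m]_y (z y * f y) = 0.
Proof.
apply/eqP; rewrite -normr_eq0; apply: contraT => nz.
set A := `|_| in nz *.
have A0 : 0 < A by rewrite lt_def nz normr_ge0.
have k0 : 0 < s * expR s by rewrite mulr_gt0// expR_gt0.
pose u := Num.min 1 (A / (2 * (s * expR s))).
have uu : 0 < u <= 1.
  apply/andP; split; last by rewrite /u ge_min lexx.
  by rewrite /u lt_min ltr01 divr_gt0// mulr_gt0.
have h := Iz_small uu; rewrite -/A in h.
have : s * expR s * u <= A / 2.
  apply: (@le_trans _ _ (s * expR s * (A / (2 * (s * expR s))))).
    by rewrite ler_pM2l// /u ge_min lexx orbT.
  rewrite le_eqVlt; apply/orP; left; apply/eqP; field.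
  by rewrite (gt_eqF s0) gt_eqF// expR_gt0.
move: h; lra.
Qed.

End subgaussian_moments.

(** * The score of the generalized linear model *)

Section psi2_second_moment.
Context {disp : measure_display} {T : measurableType disp} {R : realType}.
Variables (fx : probability T R) (Z : T -> R).
Hypothesis mZ : measurable_fun setT Z.

(** 1 + (Z/t)^2 <= exp((Z/t)^2), and the mean of the right-hand side is at most 2
for some t < k. *)
Lemma psi2_second_moment (k : R) : (psi2_norm fx Z < k%:E)%E ->
  (\int[fx]_x (Z x ^+ 2)%:E <= (k ^+ 2)%:E)%E.
Proof.
move=> /ereal_inf_lt[_ [t [t0 Et] <-]]; rewrite lte_fin => tk.
have mE : measurable_fun setT (fun x => expR ((Z x / t) ^+ 2)).
  apply: (measurableT_comp (@measurable_expR R)); apply: measurable_funX.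
  by apply: measurable_funM => //; exact: measurable_cst.
have mQ : measurable_fun setT (fun x => (Z x / t) ^+ 2).
  by apply: measurable_funX; apply: measurable_funM => //; exact: measurable_cst.
have Et' : (\int[fx]_x (expR ((Z x / t) ^+ 2))%:E <= 2%:E)%E.
  by move: Et; rewrite unlock.
have L1E : L1 fx (fun x => expR ((Z x / t) ^+ 2)).
  apply: L1_ge0_lty => //.
  by apply: le_lt_trans Et' _; rewrite ltry.
have L1Q : L1 fx (fun x => (Z x / t) ^+ 2).
  apply: L1_le L1E => // x; rewrite ger0_norm ?sqr_ge0//.
  by apply: le_trans (expR_ge1Dx _); rewrite lerDr.
have le1 : \int[fx]_x ((Z x / t) ^+ 2) <= 1.
  have L1Q1 : L1 fx (fun x => 1 + (Z x / t) ^+ 2).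
    by apply: L1D => //; exact: L1_cst.
  have := le_Rint L1Q1 L1E (fun x => expR_ge1Dx ((Z x / t) ^+ 2)).
  rewrite RintD//; last exact: L1_cst.
  rewrite Rint_cst => /le_trans; rewrite -(lerD2l 1) => /(_ 2) h.
  by apply: h; rewrite -lee_fin EFin_Rint.
have E x : Z x ^+ 2 = t ^+ 2 * (Z x / t) ^+ 2.
  by field; rewrite gt_eqF.
have L1Z : L1 fx (fun x => Z x ^+ 2).
  rewrite (_ : (fun x => _) = (fun x => t ^+ 2 * (Z x / t) ^+ 2)).
    exact: L1Zl.
  by apply/funext => x; exact: E.
rewrite -EFin_Rint// lee_fin.
under eq_Rintegral do rewrite E.
rewrite RintZl//; apply: (@le_trans _ _ (t ^+ 2)).
  by rewrite -[leRHS]mulr1 ler_wpM2l ?sqr_ge0.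
by rewrite lerXn2r ?nnegrE ?ltW// (lt_trans t0).
Qed.

End psi2_second_moment.

Section dotp_lemmas.
Context {R : realType} {d : nat}.
Implicit Types (x b : d.-tuple R).

Lemma measurable_dotp (disp : measure_display) (X : measurableType disp)
    (f g : X -> d.-tuple R) : measurable_fun setT f -> measurable_fun setT g ->
  measurable_fun setT (fun z => dotp (f z) (g z)).
Proof.
move=> mf mg; apply: measurable_sum => i; apply: measurable_funM.
  exact: (measurableT_comp (measurable_tnth i) mf).
exact: (measurableT_comp (measurable_tnth i) mg).
Qed.

Lemma dotp_tupd x b j (t : R) :
  dotp x (tupd b j t) = dotp x b + tnth x j * (t - tnth b j).
Proof.
rewrite /dotp (bigD1 j)//= [in RHS](bigD1 j)//= tnth_tupd_id.
rewrite (eq_bigr (fun i => tnth x i * tnth b i)); first by ring.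
by move=> i ij; rewrite tnth_tupd_neq.
Qed.

Lemma dotp0 x : dotp x [tuple 0 | i < d] = 0.
Proof. by apply: big1 => i _; rewrite tnth_mktuple mulr0. Qed.

Lemma l2norm_sq b : l2norm b ^+ 2 = \sum_i tnth b i ^+ 2.
Proof. by rewrite sqr_sqrtr// sumr_ge0// => i _; exact: sqr_ge0. Qed.

(** The bound |Kx| + 1 leaves room below it for a value of t admissible in the
definition of the Orlicz norm, whatever the sign of [Kx]. *)
Lemma cond_SG_second_moment (C Kx : R) (fx : probability (d.-tuple R) R) u :
  cond_SG C Kx fx ->
  (\int[fx]_x (dotp u x ^+ 2)%:E <= ((`|Kx| + 1) ^+ 2 * l2norm u ^+ 2)%:E)%E.
Proof.
move=> [_ /(_ u) h].
have m0 : 0 <= l2norm u by exact: sqrtr_ge0.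
have mZ : measurable_fun setT (fun x => dotp u x).
  by apply: measurable_dotp => //; exact: measurable_cst.
have [u0|u0] := eqVneq (l2norm u) 0.
  have uz i : tnth u i = 0.
    have /eqP : l2norm u ^+ 2 = 0 by rewrite u0 expr0n.
    rewrite l2norm_sq psumr_eq0; last by move=> k _; exact: sqr_ge0.
    by move=> /allP /(_ i (mem_index_enum i)); rewrite sqrf_eq0 => /eqP.
  rewrite u0 expr0n mulr0.
  rewrite (eq_integral (fun=> 0%E)) ?integral0// => x _.
  by rewrite /dotp big1 ?expr0n// => i _; rewrite uz mul0r.
rewrite -exprMn; apply: psi2_second_moment => //.
have lp : 0 < l2norm u by rewrite lt_def u0.
apply: le_lt_trans h _; rewrite lte_fin ltr_pM2r//.
by apply: le_lt_trans (ler_norm _) _; rewrite ltrDl.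
Qed.

End dotp_lemmas.

Section glm_score.
Context {R : realType} {n d : nat}.
Variables (psi : R -> R) (h : R -> R -> R) (cs : R -> R) (sigma c2 : R).
Variable nu : {sigma_finite_measure set R -> \bar R}.
Variable fx : probability (d.-tuple R) R.
Variable P : d.-tuple R -> probability (obs R d) R.
Variable Pn : d.-tuple R -> probability (n.-tuple (obs R d)) R.
Hypothesis c0 : 0 < cs sigma.
Hypothesis dens : forall theta : R,
  probability_density nu (glm_density psi h cs sigma theta).
Hypothesis law : forall beta, glm_law psi h cs sigma nu fx beta (P beta).
Hypothesis law_n : forall beta, iid_law (P beta) (Pn beta).
Hypothesis d1 : forall t : R, derivable psi t 1.
Hypothesis d2 : forall t : R, derivable (psi^`())%classic t 1.
Hypothesis psi2 : forall t : R, `|(psi^`(2))%classic t| <= c2.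
Hypothesis c2_gt0 : 0 < c2.
Variable kx : R.
Hypothesis x_cov : forall u : d.-tuple R,
  (\int[fx]_x (dotp u x ^+ 2)%:E <= (kx * l2norm u ^+ 2)%:E)%E.

Local Notation c := (cs sigma).
Local Notation psi' := (psi^`())%classic.
Let f := glm_density psi h cs sigma.

Definition residual (theta y : R) : R := (y - psi' theta) / c.

Definition score (j : 'I_d) (b : d.-tuple R) (z : obs R d) : R :=
  residual (dotp z.2 b) z.1 * tnth z.2 j.

(** The likelihood ratio of one record with respect to the parameter 0; the
reference density [h] cancels. *)
Definition ratio (b : d.-tuple R) (z : obs R d) : R :=
  expR ((z.1 * dotp z.2 b - psi (dotp z.2 b) + psi 0) / c).

Let mpsi : measurable_fun setT psi.
Proof.
by apply: continuous_measurable_fun => t; exact: der_continuous (der_psi d1 t).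
Qed.

Let cpsi' : continuous psi'.
Proof. by move=> t; exact: der_continuous (der_psi' d2 t). Qed.

Let mpsi' : measurable_fun setT psi'.
Proof. exact: continuous_measurable_fun. Qed.

Let mf theta : measurable_fun setT (f theta).
Proof. by case: (dens theta). Qed.

Let f0 theta y : 0 <= f theta y.
Proof. by case: (dens theta). Qed.

Let f1 theta : (\int[nu]_y (f theta y)%:E = 1)%E.
Proof. by case: (dens theta). Qed.

Let mh : measurable_fun setT (h^~ sigma).
Proof.
rewrite (_ : h^~ sigma = fun y => f 0 y * expR (psi 0 / c)); last first.
  apply/funext => y; rewrite /f /glm_density mulr0 sub0r -mulrA -expRD.
  by rewrite mulNr addNr expR0 mulr1.
by apply: measurable_funM => //; exact: measurable_cst.
Qed.

Let mres theta : measurable_fun setT (residual theta).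
Proof.
apply: measurable_funM; last exact: measurable_cst.
by apply: measurable_funB => //; exact: measurable_cst.
Qed.

Let s := c2 / c.

Let s_gt0 : 0 < s.
Proof. by rewrite divr_gt0. Qed.

(** Tilting by exp(u z) moves the exponential family from theta to theta + u, where
it is normalized; the factor that remains is the Taylor remainder of psi. *)
Lemma glm_mgf theta u :
  (\int[nu]_y (expR (u * residual theta y) * f theta y)%:E
   <= (expR (s * u ^+ 2))%:E)%E.
Proof.
pose k := expR ((psi (theta + u) - psi theta - u * psi' theta) / c).
have E y : expR (u * residual theta y) * f theta y = k * f (theta + u) y.
  rewrite /f /glm_density /k /residual mulrCA [RHS]mulrCA -!expRD.
  by congr (_ * expR _); field; rewrite gt_eqF.
under eq_integral do rewrite E EFinM.
rewrite ge0_integralZl//; first last.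
- by rewrite lee_fin expR_ge0.
- by move=> y _; rewrite lee_fin.
- exact/measurable_EFinP.
rewrite f1 mule1 lee_fin ler_expR /s mulrAC ler_pM2r ?invr_gt0//.
exact: psi_taylor.
Qed.

Let res_L1 theta : L1 nu (fun y => residual theta y * f theta y).
Proof. exact: (L1_sub1 (mf theta) (f0 theta) (f1 theta) (mres theta) s_gt0 (glm_mgf theta)). Qed.

Let res_mean theta : \int[nu]_y (residual theta y * f theta y) = 0.
Proof. exact: (Rint_sub1 (mf theta) (f0 theta) (f1 theta) (mres theta) s_gt0 (glm_mgf theta)). Qed.

Let res_var theta :
  (\int[nu]_y (residual theta y ^+ 2 * f theta y)%:E <= (8 * expR 1 * s)%:E)%E.
Proof.
rewrite -EFin_Rint; last first.
  exact: (L1_sub2 (mf theta) (f0 theta) (mres theta) s_gt0 (glm_mgf theta)).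
rewrite lee_fin.
exact: (Rint_sub2_le (mf theta) (f0 theta) (mres theta) s_gt0 (glm_mgf theta)).
Qed.

Let F b (z : obs R d) := f (dotp z.2 b) z.1.

Let mdot b : measurable_fun setT (fun z : obs R d => dotp z.2 b).
Proof.
by apply: measurable_dotp; [exact: measurable_snd|exact: measurable_cst].
Qed.

Let mF b : measurable_fun setT (F b).
Proof.
apply: measurable_funM; first exact: (measurableT_comp mh measurable_fst).
apply: (measurableT_comp (@measurable_expR R)).
apply: measurable_funM; last exact: measurable_cst.
apply: measurable_funB; last exact: (measurableT_comp mpsi (mdot b)).
by apply: measurable_funM => //; exact: measurable_fst.
Qed.

Let F0 b z : 0 <= F b z.
Proof. exact: f0. Qed.

Let PE b A : measurable A ->
  P b A = (\int[nu \x fx]_z (\1_A z * F b z)%:E)%E.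
Proof.
move=> mA; rewrite (law b mA).
rewrite (fubini_tonelli2 (fun z : obs R d => (\1_A z * F b z)%:E))//.
- by apply/measurable_EFinP; apply: measurable_funM => //; exact: measurable_indic.
- by move=> z; rewrite lee_fin mulr_ge0.
Qed.

Lemma measurable_ratio (disp : measure_display) (X : measurableType disp)
    (g : X -> d.-tuple R) (k : X -> obs R d) :
  measurable_fun setT g -> measurable_fun setT k ->
  measurable_fun setT (fun x => ratio (g x) (k x)).
Proof.
move=> mg mk.
have m2 := measurableT_comp (@measurable_snd _ _ _ _) mk.
have m1 := measurableT_comp (@measurable_fst _ _ _ _) mk.
have md := measurable_dotp m2 mg.
apply: (measurableT_comp (@measurable_expR R)).
apply: measurable_funM; last exact: measurable_cst.
apply: measurable_funD; last exact: measurable_cst.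
apply: measurable_funB; last exact: (measurableT_comp mpsi md).
exact: measurable_funM.
Qed.

Lemma measurable_score (disp : measure_display) (X : measurableType disp) j
    (g : X -> d.-tuple R) (k : X -> obs R d) :
  measurable_fun setT g -> measurable_fun setT k ->
  measurable_fun setT (fun x => score j (g x) (k x)).
Proof.
move=> mg mk.
have m2 := measurableT_comp (@measurable_snd _ _ _ _) mk.
have m1 := measurableT_comp (@measurable_fst _ _ _ _) mk.
have md := measurable_dotp m2 mg.
apply: measurable_funM; last exact: (measurableT_comp (measurable_tnth j) m2).
apply: measurable_funM; last exact: measurable_cst.
by apply: measurable_funB => //; exact: (measurableT_comp mpsi' md).
Qed.

Let o : d.-tuple R := [tuple 0 | i < d].

Let mratio b : measurable_fun setT (ratio b).
Proof. by apply: measurable_ratio => //; exact: measurable_cst. Qed.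

Lemma ratio_ge0 b z : 0 <= ratio b z.
Proof. exact: expR_ge0. Qed.

Lemma glm_ratio b A : measurable A ->
  P b A = (\int[P o]_z (\1_A z * ratio b z)%:E)%E.
Proof.
move=> mA.
rewrite (ge0_integral_density (mF o) (F0 o) (@PE o)
  (g := fun z => \1_A z * ratio b z)).
- rewrite PE//; apply: eq_integral => z _; rewrite -mulrA; congr (_ * _)%:E.
  rewrite /F /f /glm_density /ratio /o dotp0 mulr0 sub0r mulrCA -expRD.
  by congr (_ * expR _); field; rewrite gt_eqF.
- by apply: measurable_funM => //; exact: measurable_indic.
- by move=> z; rewrite mulr_ge0// ratio_ge0.
Qed.

Let mscore j b : measurable_fun setT (score j b).
Proof. by apply: measurable_score => //; exact: measurable_cst. Qed.

(** A bound on the Fisher information of one record in every direction; 8 e c2 / c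
bounds the variance of the residual and kx the second moment of u.x. *)
Definition info := 8 * expR 1 * (c2 / c) * kx.

(** Conditionally on x, u.score is the residual times u.x; integrate the residual
first. *)
Lemma score_cov b (u : 'I_d -> R) :
  (\int[P b]_z ((\sum_j u j * score j b z) ^+ 2)%:E
   <= (info * \sum_j u j ^+ 2)%:E)%E.
Proof.
pose ut : d.-tuple R := [tuple u j | j < d].
have E z : (\sum_j u j * score j b z) ^+ 2
    = dotp ut z.2 ^+ 2 * residual (dotp z.2 b) z.1 ^+ 2.
  rewrite -exprMn; congr (_ ^+ 2).
  rewrite /dotp mulr_suml; apply: eq_bigr => j _.
  by rewrite tnth_mktuple /score; ring.
have muz : measurable_fun setT (fun z : obs R d => dotp ut z.2).
  by apply: measurable_dotp; [exact: measurable_cst|exact: measurable_snd].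
have mux : measurable_fun setT (fun x : d.-tuple R => dotp ut x).
  by apply: measurable_dotp => //; exact: measurable_cst.
have mrz : measurable_fun setT (fun z : obs R d => residual (dotp z.2 b) z.1).
  apply: measurable_funM; last exact: measurable_cst.
  apply: measurable_funB; first exact: measurable_fst.
  exact: (measurableT_comp mpsi' (mdot b)).
under eq_integral do rewrite E.
rewrite (ge0_integral_density (mF b) (F0 b) (@PE b)
  (g := fun z => dotp ut z.2 ^+ 2 * residual (dotp z.2 b) z.1 ^+ 2)); last 2 first.
- by apply: measurable_funM; apply: measurable_funX.
- by move=> z; rewrite mulr_ge0 ?sqr_ge0.
rewrite (fubini_tonelli2 (fun z : obs R d =>
  (dotp ut z.2 ^+ 2 * residual (dotp z.2 b) z.1 ^+ 2 * F b z)%:E)); last 2 first.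
- apply/measurable_EFinP; apply: measurable_funM => //.
  by apply: measurable_funM; apply: measurable_funX.
- by move=> z; rewrite lee_fin mulr_ge0// mulr_ge0 ?sqr_ge0.
apply: (@le_trans _ _ (\int[fx]_x ((8 * expR 1 * s)%:E * (dotp ut x ^+ 2)%:E)%E)%E).
  apply: ge0_le_integral => //.
  - by move=> x _; apply: integral_ge0 => y _; rewrite lee_fin mulr_ge0// mulr_ge0 ?sqr_ge0.
  - have := @measurable_fun_fubini_tonelli_G _ _ _ _ R nu (fun z : obs R d =>
      (dotp ut z.2 ^+ 2 * residual (dotp z.2 b) z.1 ^+ 2 * F b z)%:E).
    apply.
    + apply/measurable_EFinP; apply: measurable_funM => //.
      by apply: measurable_funM; apply: measurable_funX.
    + by move=> z; rewrite lee_fin mulr_ge0// mulr_ge0 ?sqr_ge0.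
  - apply: measurable_funeM; apply/measurable_EFinP; exact: measurable_funX.
  - move=> x _; rewrite /fubini_G /F /=.
    under eq_integral do rewrite -mulrA EFinM.
    rewrite ge0_integralZl//; first last.
    + by rewrite lee_fin sqr_ge0.
    + by move=> y _; rewrite lee_fin mulr_ge0// sqr_ge0.
    + apply/measurable_EFinP; apply: measurable_funM => //.
      exact: measurable_funX.
    by rewrite muleC lee_wpmul2r ?lee_fin ?sqr_ge0.
have k0 : 0 <= 8 * expR 1 * s by rewrite mulr_ge0 ?(ltW s_gt0)// mulr_ge0 ?expR_ge0.
rewrite ge0_integralZl//; first last.
- by move=> x _; rewrite lee_fin sqr_ge0.
- by apply/measurable_EFinP; exact: measurable_funX.
apply: (@le_trans _ _ ((8 * expR 1 * s)%:E * (kx * l2norm ut ^+ 2)%:E)%E).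
  by rewrite lee_wpmul2l.
rewrite -EFinM lee_fin l2norm_sq [leLHS]mulrA.
by under eq_bigr do rewrite tnth_mktuple.
Qed.

Let score_sq b j : (\int[P b]_z (score j b z ^+ 2)%:E <= info%:E)%E.
Proof.
have := score_cov b (fun k => (k == j)%:R).
rewrite (_ : \sum_k _ = 1) ?mulr1; last first.
  by under eq_bigr do rewrite expr2; rewrite sum_delta eqxx.
apply: le_trans; apply: ge0_le_integral => //.
- by move=> z _; rewrite lee_fin sqr_ge0.
- by apply/measurable_EFinP; exact: measurable_funX.
- apply/measurable_EFinP; apply: measurable_funX.
  by apply: measurable_sum => k; apply: measurable_funM => //; exact: measurable_cst.
- by move=> z _; rewrite sum_delta.
Qed.

Let L1_score_sq b j : L1 (P b) (fun z => score j b z ^+ 2).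
Proof.
apply: L1_ge0_lty; first exact: measurable_funX.
  by move=> z; exact: sqr_ge0.
by apply: le_lt_trans (score_sq b j) _; rewrite ltry.
Qed.

Let L1_score_sq1 b j : L1 (P b) (fun z => (score j b z ^+ 2 + 1) / 2).
Proof. by apply: L1Zr; apply: L1D => //; exact: L1_cst. Qed.

Lemma L1_score b j : L1 (P b) (score j b).
Proof.
exact: (L1_le (mscore j b) (fun z => norm_le_half_sqr (score j b z))
  (L1_score_sq1 b j)).
Qed.

Lemma score_abs b j : \int[P b]_z `|score j b z| <= (info + 1) / 2.
Proof.
have L1s := L1_score b j.
apply: le_trans (le_Rint (L1_norm L1s) (L1_score_sq1 b j)
  (fun z => norm_le_half_sqr (score j b z))) _.
rewrite RintZr; last by apply: L1D => //; exact: L1_cst.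
rewrite RintD//; last exact: L1_cst.
rewrite Rint_cst ler_wpM2r// lerD2r -lee_fin EFin_Rint; first exact: score_sq.
exact: L1_score_sq.
Qed.

Lemma score_mean b j : \int[P b]_z score j b z = 0.
Proof.
have L1s := L1_score b j.
rewrite (Rint_density (mF b) (F0 b) (@PE b) L1s).
have i := (L1_density (mF b) (F0 b) (@PE b) (L1_measurable L1s)).1 L1s.
rewrite /Rintegral -(integral21_prod_meas1 i) /fubini_G.
rewrite (eq_integral (fun=> 0%E)) ?integral0// => x _.
rewrite -[LHS]/(\int[nu]_y (residual (dotp x b) y * tnth x j * f (dotp x b) y)%:E)%E.
under eq_integral do rewrite mulrAC.
rewrite -EFin_Rint; last exact: (L1Zr (tnth x j) (res_L1 (dotp x b))).
by rewrite RintZr// res_mean mul0r.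
Qed.

Definition lik (b : d.-tuple R) (D : n.-tuple (obs R d)) : R :=
  \prod_(i < n) ratio b (tnth D i).

Definition score_n (j : 'I_d) (b : d.-tuple R) (D : n.-tuple (obs R d)) : R :=
  \sum_(i < n) score j b (tnth D i).

Lemma lik_ge0 b D : 0 <= lik b D.
Proof. by apply: prodr_ge0 => i _; exact: ratio_ge0. Qed.

Lemma measurable_lik :
  measurable_fun setT (fun u : d.-tuple R * n.-tuple (obs R d) => lik u.1 u.2).
Proof.
apply: measurable_prod => i _; apply: measurable_ratio; first exact: measurable_fst.
exact: (measurableT_comp (measurable_tnth i) measurable_snd).
Qed.

Lemma measurable_score_n j :
  measurable_fun setT (fun u : d.-tuple R * n.-tuple (obs R d) => score_n j u.1 u.2).
Proof.
apply: measurable_sum => i; apply: measurable_score; first exact: measurable_fst.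
exact: (measurableT_comp (measurable_tnth i) measurable_snd).
Qed.

Lemma lik_density b E : measurable E ->
  Pn b E = (\int[Pn o]_D (\1_E D * lik b D)%:E)%E.
Proof.
move=> mE.
exact: (iid_density (law_n o) (law_n b) (mratio b) (ratio_ge0 b) (@glm_ratio b) mE).
Qed.

Lemma lik_int b : (\int[Pn o]_D (lik b D)%:E = 1)%E.
Proof.
rewrite -(probability_setT (Pn b)) lik_density//; apply: eq_integral => D _.
by rewrite indicT mul1r.
Qed.

(** [lik] is the exponential of a sum whose terms are compositions of psi with an
affine function of the j-th coordinate. *)
Lemma lik_der b D j (t : R) :
  is_derive t 1 (fun x => lik (tupd b j x) D)
    (score_n j (tupd b j t) D * lik (tupd b j t) D).
Proof.
pose g (i : 'I_n) (x : R) := ((tnth D i).1 * dotp (tnth D i).2 (tupd b j x)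
   - psi (dotp (tnth D i).2 (tupd b j x)) + psi 0) / c.
have E x : lik (tupd b j x) D = expR (\sum_(i < n) g i x) by rewrite expR_sum.
have gd i : is_derive t 1 (g i) (score j (tupd b j t) (tnth D i)).
  pose q (x : R) := dotp (tnth D i).2 (tupd b j x).
  have qd : is_derive t 1 q (tnth (tnth D i).2 j).
    rewrite (_ : q = (fun x => dotp (tnth D i).2 b
        + tnth (tnth D i).2 j * (x - tnth b j))); last first.
      by apply/funext => x; rewrite /q dotp_tupd.
    apply: (is_derive_eq (derD (der_cst _ t) (derM (der_cst _ t)
      (derB (der_id t) (der_cst _ t))))).
    by ring.
  have pd := der_comp qd (der_psi d1 (q t)).
  apply: (is_derive_eq (derM (derD (derB (derM (der_cst (tnth D i).1 t) qd) pd)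
    (der_cst (psi 0) t)) (der_cst c^-1 t))).
  by rewrite /score /residual -/(q t); ring.
have := der_comp (der_sum gd) (is_derive_expR (\sum_(i < n) g i t)).
rewrite -E mulrC (_ : (fun x => expR _) = (fun x => lik (tupd b j x) D)) //.
by apply/funext => x; rewrite E.
Qed.

Lemma score_n_cont b D j : continuous (fun x : R => score_n j (tupd b j x) D).
Proof.
move=> t; rewrite /score_n.
have cc i : {for t, continuous (fun x : R => score j (tupd b j x) (tnth D i))}.
  pose q (x : R) := dotp (tnth D i).2 (tupd b j x).
  have qc : {for t, continuous q}.
    rewrite (_ : q = (fun x => dotp (tnth D i).2 b
        + tnth (tnth D i).2 j * (x - tnth b j))); last first.
      by apply/funext => x; rewrite /q dotp_tupd.
    apply: cvgD; first exact: cvg_cst.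
    apply: cvgM; first exact: cvg_cst.
    by apply: cvgB; [exact: cvg_id|exact: cvg_cst].
  apply: cvgM; last exact: cvg_cst.
  apply: cvgM; last exact: cvg_cst.
  apply: cvgB; first exact: cvg_cst.
  exact: (continuous_comp qc (@cpsi' (q t))).
elim: (index_enum _) => [|i r ih].
  by under eq_fun do rewrite big_nil; exact: cvg_cst.
under eq_fun do rewrite big_cons.
exact: (cvgD (cc i) ih).
Qed.

End glm_score.

(** * The attack on a private algorithm *)

Section lower_bound.
Context {R : realType} {n d : nat}.
Variables (psi : R -> R) (h : R -> R -> R) (cs : R -> R) (sigma c2 : R).
Variable nu : {sigma_finite_measure set R -> \bar R}.
Variable fx : probability (d.-tuple R) R.
Variable P : d.-tuple R -> probability (obs R d) R.
Variable Pn : d.-tuple R -> probability (n.-tuple (obs R d)) R.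
Hypothesis c0 : 0 < cs sigma.
Hypothesis dens : forall theta : R,
  probability_density nu (glm_density psi h cs sigma theta).
Hypothesis law : forall beta, glm_law psi h cs sigma nu fx beta (P beta).
Hypothesis law_n : forall beta, iid_law (P beta) (Pn beta).
Hypothesis d1 : forall t : R, derivable psi t 1.
Hypothesis d2 : forall t : R, derivable (psi^`())%classic t 1.
Hypothesis psi2 : forall t : R, `|(psi^`(2))%classic t| <= c2.
Hypothesis c2_gt0 : 0 < c2.
Variable kx : R.
Hypothesis x_cov : forall u : d.-tuple R,
  (\int[fx]_x (dotp u x ^+ 2)%:E <= (kx * l2norm u ^+ 2)%:E)%E.
Variables (a r : R) (M : @algorithm R n d).
Hypothesis a_gt0 : 0 < a.
Hypothesis risk : forall b : d.-tuple R, (forall i, `|tnth b i| <= a) ->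
  (sq_risk (Pn b) M b <= r%:E)%E.

Let S := @score R d psi cs sigma.
Let lam := info cs sigma c2 kx.
Let o : d.-tuple R := [tuple 0 | i < d].

Let scov b (u : 'I_d -> R) :
  (\int[P b]_z ((\sum_j u j * S j b z) ^+ 2)%:E <= (lam * \sum_j u j ^+ 2)%:E)%E.
Proof. exact: (score_cov c0 dens law d1 d2 psi2 c2_gt0 x_cov). Qed.

Let smean b j : \int[P b]_z S j b z = 0.
Proof. exact: (score_mean c0 dens law d1 d2 psi2 c2_gt0 x_cov). Qed.

Let mS b j : measurable_fun setT (S j b).
Proof.
by apply: (measurable_score cs sigma d2 j) => //; exact: measurable_cst.
Qed.

(* error of the clamped output, its mean given the data, the weighted error, and
   the clamped quadratic risk given the data *)
Let w (b : d.-tuple R) (j : 'I_d) (y : d.-tuple R) : R := clamp a (tnth y j) - tnth b j.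
Let m (j : 'I_d) (D : n.-tuple (obs R d)) : R := \int[kernel_prob M D]_y clamp a (tnth y j).
Let v b j y : R := bump a (tnth b j) * w b j y.
Let G b D : R := \int[kernel_prob M D]_y (\sum_j w b j y ^+ 2).

Let mcl j : measurable_fun setT (fun y : d.-tuple R => clamp a (tnth y j)).
Proof. exact: (measurableT_comp (measurable_clamp a) (measurable_tnth j)). Qed.

Let mw b j : measurable_fun setT (w b j).
Proof. by apply: measurable_funB => //; exact: measurable_cst. Qed.

Let mv b j : measurable_fun setT (v b j).
Proof. by apply: measurable_funM => //; exact: measurable_cst. Qed.

Let clb j (y : d.-tuple R) : `|clamp a (tnth y j)| <= a.
Proof. by apply: clamp_norm; exact: ltW. Qed.

Let L1cl j D : L1 (kernel_prob M D) (fun y => clamp a (tnth y j)).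
Proof. exact: (L1_bounded _ (mcl j) (clb j)). Qed.

Let mm j : measurable_fun setT (m j).
Proof. exact: (measurable_kernel_Rint M (mcl j) (clb j)). Qed.

Let m_le j D : `|m j D| <= a.
Proof. exact: (norm_Rint_le _ (mcl j) (clb j)). Qed.

Section at_beta.
Variable b : d.-tuple R.
Hypothesis ba : forall i, `|tnth b i| <= a.

Let wb j y : `|w b j y| <= 2 * a.
Proof. by apply: le_trans (ler_normB _ _) _; have := clb j y; have := ba j; lra. Qed.

Let bump01 j : 0 <= bump a (tnth b j) <= 1.
Proof. exact: (bump_01 a_gt0 (ba j)). Qed.

Let vw j y : `|v b j y| <= `|w b j y|.
Proof.
have /andP[h1 h2] := bump01 j.
by rewrite normrM (ger0_norm h1) -[leRHS]mul1r ler_wpM2r.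
Qed.

Let vb j y : `|v b j y| <= 2 * a.
Proof. exact: le_trans (vw j y) (wb j y). Qed.

Let w2b j y : `|w b j y ^+ 2| <= (2 * a) ^+ 2.
Proof.
by rewrite normrX lerXn2r ?nnegrE ?normr_ge0// mulr_ge0 ?(ltW a_gt0).
Qed.

Let mw2 j : measurable_fun setT (fun y => w b j y ^+ 2).
Proof. exact: measurable_funX. Qed.

Let L1w j D : L1 (kernel_prob M D) (w b j).
Proof. exact: (L1_bounded _ (mw b j) (wb j)). Qed.

Let L1w2 j D : L1 (kernel_prob M D) (fun y => w b j y ^+ 2).
Proof. exact: (L1_bounded _ (mw2 j) (w2b j)). Qed.

Let GE D : G b D = \sum_j \int[kernel_prob M D]_y (w b j y ^+ 2).
Proof. by rewrite /G Rint_sum. Qed.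

Let L1_wj2 j : L1 (Pn b) (fun D => \int[kernel_prob M D]_y (w b j y ^+ 2)).
Proof.
apply: (L1_bounded _ (measurable_kernel_Rint M (mw2 j) (w2b j))) => D.
exact: (norm_Rint_le _ (mw2 j) (w2b j)).
Qed.

Let L1G : L1 (Pn b) (G b).
Proof.
rewrite (_ : G b = fun D => \sum_j \int[kernel_prob M D]_y (w b j y ^+ 2)).
  exact: L1_sum.
by apply/funext => D; exact: GE.
Qed.

Let w2_dist j y : w b j y ^+ 2 <= (tnth y j - tnth b j) ^+ 2.
Proof.
rewrite -(real_normK (num_real (w b j y))) -(real_normK (num_real (_ - _))).
by rewrite lerXn2r ?nnegrE// clamp_dist// -ler_norml.
Qed.

(** Clamping to a box that contains the parameter does not increase the distance. *)
Lemma clamped_risk_le : \int[Pn b]_D G b D <= r.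
Proof.
rewrite -lee_fin EFin_Rint//; apply: le_trans (risk ba); rewrite /sq_risk.
have mn : measurable_fun setT (fun y : d.-tuple R => (l2norm (subv y b) ^+ 2)%:E).
  apply/measurable_EFinP.
  rewrite (_ : (fun y => _) = fun y => \sum_j (tnth y j - tnth b j) ^+ 2).
    apply: measurable_sum => j; apply: measurable_funX.
    apply: measurable_funB; last exact: measurable_cst.
    exact: measurable_tnth.
  apply/funext => y; rewrite l2norm_sq; apply: eq_bigr => j _.
  by rewrite tnth_mktuple.
apply: ge0_le_integral => //.
- move=> D _; rewrite lee_fin; apply: Rintegral_ge0 => y _.
  by apply: sumr_ge0 => j _; exact: sqr_ge0.
- by apply/measurable_EFinP; exact: L1_measurable L1G.
- apply: (measurable_fun_integral_finite_kernel
    (fun u : n.-tuple (obs R d) * d.-tuple R => (l2norm (subv u.2 b) ^+ 2)%:E) M).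
    by move=> u; rewrite lee_fin sqr_ge0.
  exact: (measurableT_comp mn measurable_snd).
- move=> D _; rewrite /G EFin_Rint; last exact: L1_sum.
  rewrite -[leRHS]/(\int[kernel_prob M D]_y (l2norm (subv y b) ^+ 2)%:E)%E.
  apply: ge0_le_integral => //.
  + by move=> y _; rewrite lee_fin; apply: sumr_ge0 => j _; exact: sqr_ge0.
  + by apply/measurable_EFinP; exact: measurable_sum.
  + move=> y _; rewrite lee_fin l2norm_sq; apply: ler_sum => j _.
    by rewrite tnth_mktuple.
Qed.

Let V j D := \int[kernel_prob M D]_y v b j y.

Let VE j D : V j D = bump a (tnth b j) * (m j D - tnth b j).
Proof.
rewrite /V RintZl//; congr (_ * _); rewrite /w RintB//; last exact: L1_cst.
by rewrite Rint_cst.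
Qed.

Definition attack_total : R :=
  \int[Pn b]_D (\sum_(i < n) \sum_j V j D * S j b (tnth D i)).

Let g_le : \int[Pn b]_D (\int[kernel_prob M D]_y (\sum_j v b j y ^+ 2)) <= r.
Proof.
apply: le_trans clamped_risk_le.
have v2b j y : `|v b j y ^+ 2| <= (2 * a) ^+ 2.
  by rewrite normrX lerXn2r ?nnegrE ?normr_ge0// mulr_ge0 ?(ltW a_gt0).
have mv2 j : measurable_fun setT (fun y => v b j y ^+ 2) by exact: measurable_funX.
have L1v2 j D : L1 (kernel_prob M D) (fun y => v b j y ^+ 2).
  exact: (L1_bounded _ (mv2 j) (v2b j)).
apply: le_Rint => //.
  rewrite (_ : (fun D => _) = fun D => \sum_j \int[kernel_prob M D]_y (v b j y ^+ 2)).
    apply: L1_sum => j.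
    apply: (L1_bounded _ (measurable_kernel_Rint M (mv2 j) (v2b j))) => D.
    exact: (norm_Rint_le _ (mv2 j) (v2b j)).
  by apply/funext => D; rewrite Rint_sum.
move=> D; apply: le_Rint; [exact: L1_sum|exact: L1_sum|].
move=> y; apply: ler_sum => j _.
rewrite -(real_normK (num_real (v b j y))) -(real_normK (num_real (w b j y))).
by rewrite lerXn2r ?nnegrE.
Qed.

Lemma attack_total_le_info (k : R) : 0 < k ->
  attack_total <= (k * r + n%:R * d%:R * lam / k) / 2.
Proof.
move=> k0.
apply: le_trans (attack_le_info M (law_n b) (mv b) vb (mS b) (smean b) (scov b) k0) _.
by rewrite ler_wpM2r// lerD2r ler_wpM2l ?(ltW k0)// g_le.
Qed.

Lemma attack_total_le_dp (eps delta k : R) : 0 <= eps -> 0 <= delta ->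
  M \in dp_algorithms eps delta -> 0 < k -> 0 <= lam ->
  attack_total <= n%:R * ((expR eps - 1) * (k * (lam * r) + k^-1) / 2
     + delta * (2 * a) * d%:R * (lam + 1)).
Proof.
move=> e0 de0 /set_mem Mdp k0 lam0.
have e1 : 1 <= expR eps by rewrite -expR0 ler_expR.
have dpM D i z A : measurable A ->
    (M (tupd D i z) A <= (expR eps)%:E * M D A + delta%:E)%E /\
    (M D A <= (expR eps)%:E * M (tupd D i z) A + delta%:E)%E.
  by move=> mA; split; apply: Mdp => //; exists i => j ji; rewrite tnth_tupd_neq.
have b0' : 0 <= 2 * a by rewrite mulr_ge0 ?(ltW a_gt0).
rewrite /attack_total Rint_sum; last first.
  by move=> i; exact: (L1_attack M (law_n b) (mv b) vb (mS b) (scov b)).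
rewrite -[X in X%:R * _](card_ord n) mulr_natl -sumr_const.
apply: ler_sum => i _.
apply: le_trans (attack_le_dp (law_n b) (mv b) vb (mS b) (smean b) (scov b)
  e1 de0 dpM b0' i k0) _.
rewrite lerD2r ler_wpM2r// ler_wpM2l ?subr_ge0// lerD2r ler_wpM2l ?(ltW k0)//.
by rewrite ler_wpM2l// g_le.
Qed.

Let sn (j : 'I_d) := @score_n R n d psi cs sigma j.
Let p := @lik R n d psi cs sigma.

Let lik_Rint (g : n.-tuple (obs R d) -> R) : L1 (Pn b) g ->
  \int[Pn b]_D g D = \int[Pn o]_D (g D * p b D).
Proof.
move=> ig; apply: Rint_density => //.
- exact: (measurableT_comp (measurable_lik cs sigma d1) (measurable_pair1 b)).
- by move=> D; exact: lik_ge0.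
- by move=> A mA; exact: (lik_density c0 dens law law_n d1 b mA).
Qed.

Let L1m j : L1 (Pn b) (m j).
Proof. exact: (L1_bounded _ (mm j) (m_le j)). Qed.

Let L1_Vs j : L1 (Pn b) (fun D => V j D * sn j b D).
Proof.
have L1S i : L1 (Pn b) (fun D => S j b (tnth D i)).
  apply: (L1_marginal (law_n b) i).
  exact: (L1_score c0 dens law d1 d2 psi2 c2_gt0 x_cov).
apply: (L1_le (g := fun D => 2 * a * `|sn j b D|)).
- apply: measurable_funM.
    exact: (measurable_kernel_Rint M (mv b j) (vb j)).
  exact: (measurableT_comp (measurable_score_n cs sigma d2 j) (measurable_pair1 b)).
- move=> D; rewrite normrM ler_wpM2r//.
  exact: (norm_Rint_le _ (mv b j) (vb j)).
- by apply: L1Zl; apply: L1_norm; exact: L1_sum.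
Qed.

(** |bump'| <= 2/a on the box, then Young's inequality. *)
Let bias_le (k : R) D : 0 < k ->
  \sum_j bump' a (tnth b j) * (m j D - tnth b j) <= (k * G b D + d%:R / k) / a.
Proof.
move=> k0.
have -> : d%:R / k = \sum_(j < d) k^-1 by rewrite sumr_const card_ord mulr_natl.
rewrite GE mulr_sumr -big_split /= mulr_suml.
apply: ler_sum => j _.
have -> : m j D - tnth b j = \int[kernel_prob M D]_y w b j y.
  by rewrite RintB//; [rewrite Rint_cst|exact: L1_cst].
rewrite -RintZl// -RintZl// -[k^-1](Rint_cst (kernel_prob M D)).
have i1 : L1 (kernel_prob M D) (fun y => k * w b j y ^+ 2) by exact: L1Zl.
have i2 : L1 (kernel_prob M D) (fun=> k^-1) by exact: L1_cst.
rewrite -RintD// -RintZr; last exact: L1D.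
apply: le_Rint; [exact: L1Zl|by apply: L1Zr; exact: L1D|].
move=> y; apply: le_trans (ler_norm _) _; rewrite normrM.
apply: (@le_trans _ _ (2 / a * `|w b j y|)).
  by rewrite ler_wpM2r//; exact: (bump'_le a_gt0 (ba j)).
rewrite mulrAC ler_pM2r ?invr_gt0//.
have := young `|w b j y| 1 k0; rewrite expr1n !mulr1 real_normK ?num_real//.
by rewrite ler_pdivlMr// mulrC.
Qed.

Let K j D := stein_kernel a p sn m j b D.

(** Under the parameter [b] the kernel is the sum of a bias term, of minus the
bump, and of the attack statistic. *)
Lemma stein_kernel_sum_le (k : R) : 0 < k ->
  \sum_j \int[Pn o]_D K j D
  <= (k * r + d%:R / k) / a + attack_total - \sum_j bump a (tnth b j).
Proof.
move=> k0.
pose t1 j D := bump' a (tnth b j) * (m j D - tnth b j).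
have L1t1 j : L1 (Pn b) (t1 j).
  by apply: L1Zl; apply: L1B => //; exact: L1_cst.
have L1c j : L1 (Pn b) (fun=> bump a (tnth b j)) by exact: L1_cst.
have KE j : \int[Pn o]_D K j D =
    \int[Pn b]_D t1 j D - bump a (tnth b j) + \int[Pn b]_D (V j D * sn j b D).
  rewrite -[X in _ - X + _](Rint_cst (Pn b)) -RintB// -RintD//; last exact: L1B.
  rewrite lik_Rint; last by apply: L1D => //; exact: L1B.
  by apply: eq_Rintegral => D _; rewrite VE.
rewrite (eq_bigr _ (fun j _ => KE j)) big_split /= sumrB [leLHS]addrAC lerD2r.
apply: lerD.
  rewrite -Rint_sum//.
  apply: (@le_trans _ _ (\int[Pn b]_D ((k * G b D + d%:R / k) / a))).
    apply: le_Rint; first exact: L1_sum.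
      by apply: L1Zr; apply: L1D; [exact: L1Zl|exact: L1_cst].
    by move=> D; exact: bias_le.
  rewrite RintZr; last by apply: L1D; [exact: L1Zl|exact: L1_cst].
  rewrite ler_wpM2r ?invr_ge0 ?(ltW a_gt0)//.
  rewrite RintD; [|exact: L1Zl|exact: L1_cst].
  by rewrite Rint_cst RintZl// lerD2r ler_wpM2l ?(ltW k0)// clamped_risk_le.
rewrite /attack_total -Rint_sum// le_eqVlt; apply/orP; left; apply/eqP.
apply: eq_Rintegral => D _; rewrite exchange_big /=; apply: eq_bigr => j _.
by rewrite mulr_sumr.
Qed.

End at_beta.

(** This is where a small risk forces the attack to succeed: [stein_bound] applied
to the likelihood of the whole sample. *)
Lemma completeness (z k : R) : 0 < k ->
  (forall b : d.-tuple R, (forall i, `|tnth b i| <= a) -> attack_total b <= z) ->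
  2 / 3 * d%:R <= (k * r + d%:R / k) / a + z.
Proof.
move=> k0 Hz.
have [pi pi_iid] := iid_exists (unif a_gt0) d.
pose sn (j : 'I_d) := @score_n R n d psi cs sigma j.
pose p := @lik R n d psi cs sigma.
have mp := @measurable_lik R n d psi cs sigma d1.
have ms j := @measurable_score_n R n d psi cs sigma d2 j.
have s_int b j : (\int[Pn o]_D (`|sn j b D| * p b D)%:E
    <= (n%:R * ((lam + 1) / 2))%:E)%E.
  have mb : measurable_fun setT (sn j b).
    exact: (measurableT_comp (ms j) (measurable_pair1 b)).
  have mlb : measurable_fun setT (p b).
    exact: (measurableT_comp mp (measurable_pair1 b)).
  have PE A : measurable A -> Pn b A = (\int[Pn o]_D (\1_A D * p b D)%:E)%E.
    exact: (lik_density c0 dens law law_n d1 b).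
  have mnb : measurable_fun setT (fun D => `|sn j b D|) by exact: measurableT_comp.
  rewrite -(ge0_integral_density mlb (lik_ge0 psi cs sigma b) PE mnb)//.
  have L1s := L1_score c0 dens law d1 d2 psi2 c2_gt0 x_cov b j.
  have L1S i : L1 (Pn b) (fun D => S j b (tnth D i)).
    exact: (L1_marginal (law_n b) i L1s).
  rewrite -EFin_Rint; last by apply: L1_norm; exact: L1_sum.
  rewrite lee_fin.
  apply: (@le_trans _ _ (\int[Pn b]_D (\sum_(i < n) `|S j b (tnth D i)|))).
    apply: le_Rint.
    - by apply: L1_norm; exact: L1_sum.
    - by apply: L1_sum => i; exact: L1_norm.
    - by move=> D; exact: ler_norm_sum.
  rewrite Rint_sum; last by move=> i; exact: L1_norm.
  rewrite -[X in X%:R * _](card_ord n) mulr_natl -sumr_const.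
  apply: ler_sum => i _.
  rewrite (Rint_marginal (law_n b) i (L1_norm L1s)).
  exact: (score_abs c0 dens law d1 d2 psi2 c2_gt0 x_cov b j).
apply: (stein_bound (lik_ge0 psi cs sigma) mp ms mm m_le
  (lik_der cs sigma d1) (score_n_cont d2)
  (lik_int c0 dens law law_n d1) s_int pi_iid).
move=> b ba; apply: le_trans (stein_kernel_sum_le ba k0) _.
by rewrite lerD2r lerD2l; exact: Hz.
Qed.

End lower_bound.

(** * From the attack to the two rates *)

Section arithmetic.
Context {R : realType}.
Implicit Types (a b d n r lam g : R).

(** The choice k = 12 / a in the bias term. *)
Lemma bias_small a b d r : 0 < a -> a ^+ 2 * d = b ^+ 2 ->
  r <= b ^+ 2 / 144 ->
  (12 / a * r + d / (12 / a)) / a <= d / 6.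
Proof.
move=> a0 ad rb.
have -> : (12 / a * r + d / (12 / a)) / a = 12 * r / a ^+ 2 + d / 12.
  by field; rewrite gt_eqF.
have : 12 * r / a ^+ 2 <= d / 12; last by lra.
rewrite ler_pdivrMr ?exprn_gt0//.
have -> : d / 12 * a ^+ 2 = b ^+ 2 / 12 by rewrite -ad; ring.
lra.
Qed.

(** Take k = 3 n lam, which makes the last term equal to d / 6. *)
Lemma nonprivate_rate d n r lam : 0 < d -> 0 < n -> 0 < lam ->
  (forall k, 0 < k -> d / 2 <= (k * r + n * d * lam / k) / 2) ->
  2 * d / (9 * (n * lam)) <= r.
Proof.
move=> d0 n0 l0 H.
have nl0 : 0 < n * lam by rewrite mulr_gt0.
have := H (3 * (n * lam)); rewrite mulr_gt0// => /(_ isT).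
have -> : n * d * lam / (3 * (n * lam)) = d / 3.
  by field; rewrite !gt_eqF.
move=> h; rewrite ler_pdivrMr ?mulr_gt0//; lra.
Qed.

(** Take k = 4 g / d, which makes the last term equal to d / 8. *)
Lemma private_rate d n r lam g : 0 < d -> 0 < n -> 0 < lam -> 0 < g -> 0 <= r ->
  (forall k, 0 < k -> d / 4 <= g * (k * (lam * r) + k^-1) / 2) ->
  d ^+ 2 / (16 * g ^+ 2 * lam) <= r.
Proof.
move=> d0 n0 l0 g0 r0 H.
have := H (4 * g / d); rewrite divr_gt0 ?mulr_gt0// => /(_ isT).
have -> : g * (4 * g / d * (lam * r) + (4 * g / d)^-1) / 2 =
    2 * g ^+ 2 * lam * r / d + d / 8.
  by field; rewrite !gt_eqF.
move=> h.
have : d / 8 <= 2 * g ^+ 2 * lam * r / d by lra.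
rewrite ler_pdivlMr// => h2.
rewrite ler_pdivrMr; last by rewrite !mulr_gt0// exprn_gt0.
rewrite expr2; lra.
Qed.

End arithmetic.

Section rates.
Context {R : realType} {n d : nat}.
Variables (psi : R -> R) (h : R -> R -> R) (cs : R -> R) (sigma c2 : R).
Variable nu : {sigma_finite_measure set R -> \bar R}.
Variable fx : probability (d.-tuple R) R.
Variable P : d.-tuple R -> probability (obs R d) R.
Variable Pn : d.-tuple R -> probability (n.-tuple (obs R d)) R.
Hypothesis c0 : 0 < cs sigma.
Hypothesis dens : forall theta : R,
  probability_density nu (glm_density psi h cs sigma theta).
Hypothesis law : forall beta, glm_law psi h cs sigma nu fx beta (P beta).
Hypothesis law_n : forall beta, iid_law (P beta) (Pn beta).
Hypothesis d1 : forall t : R, derivable psi t 1.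
Hypothesis d2 : forall t : R, derivable (psi^`())%classic t 1.
Hypothesis psi2 : forall t : R, `|(psi^`(2))%classic t| <= c2.
Hypothesis c2_gt0 : 0 < c2.
Variable kx : R.
Hypothesis kx_gt0 : 0 < kx.
Hypothesis x_cov : forall u : d.-tuple R,
  (\int[fx]_x (dotp u x ^+ 2)%:E <= (kx * l2norm u ^+ 2)%:E)%E.
Variables (b0 r eps delta : R) (M : @algorithm R n d).
Hypothesis b0_gt0 : 0 < b0.
Hypothesis n_gt0 : (0 < n)%N.
Hypothesis d_gt0 : (0 < d)%N.
Hypothesis eps01 : 0 < eps < 1.
Hypothesis delta_ge0 : 0 <= delta.
Hypothesis r_ge0 : 0 <= r.
Hypothesis risk : forall b : d.-tuple R, l2ball b0 b ->
  (sq_risk (Pn b) M b <= r%:E)%E.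
Hypothesis Mdp : dp_algorithms eps delta M.
Hypothesis r_small : r <= b0 ^+ 2 / 144.

Let lam := info cs sigma c2 kx.

Let lam_gt0 : 0 < lam.
Proof.
by rewrite /lam /info mulr_gt0// mulr_gt0 ?divr_gt0// mulr_gt0// expR_gt0.
Qed.

Let dR : 0 < d%:R :> R. Proof. by rewrite ltr0n. Qed.
Let nR : 0 < n%:R :> R. Proof. by rewrite ltr0n. Qed.

Let a := b0 / Num.sqrt d%:R.

Let a_gt0 : 0 < a.
Proof. by rewrite divr_gt0// sqrtr_gt0. Qed.

Let ad : a ^+ 2 * d%:R = b0 ^+ 2.
Proof.
rewrite /a expr_div_n sqr_sqrtr ?ler0n// divfK//.
by rewrite gt_eqF.
Qed.

Let box_risk (b : d.-tuple R) : (forall i, `|tnth b i| <= a) ->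
  (sq_risk (Pn b) M b <= r%:E)%E.
Proof.
move=> ba; apply: risk; rewrite /l2ball /=.
rewrite -(@ler_pXn2r _ 2)//; [|by rewrite nnegrE sqrtr_ge0|by rewrite nnegrE ltW].
rewrite l2norm_sq -ad -[X in _ * X%:R](card_ord d) mulr_natr -sumr_const.
apply: ler_sum => i _; rewrite -(real_normK (num_real _)).
by rewrite lerXn2r ?nnegrE// ltW.
Qed.

Let tradeoff (z : R) :
  (forall b : d.-tuple R, (forall i, `|tnth b i| <= a) ->
     attack_total psi cs sigma Pn a M b <= z) -> d%:R / 2 <= z.
Proof.
move=> Hz; have k0 : 0 < 12 / a by rewrite divr_gt0.
have h1 := completeness c0 dens law law_n d1 d2 psi2 c2_gt0 x_cov a_gt0 box_risk k0 Hz.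
have h2 := bias_small a_gt0 ad r_small.
lra.
Qed.

Lemma risk_ge_nonprivate : 2 * d%:R / (9 * (n%:R * lam)) <= r.
Proof.
apply: nonprivate_rate => // k k0; apply: tradeoff => b ba.
exact: (attack_total_le_info c0 dens law law_n d1 d2 psi2 c2_gt0 x_cov a_gt0 box_risk ba k0).
Qed.

Lemma risk_ge_private :
  n%:R * (delta * (2 * a) * d%:R * (lam + 1)) <= d%:R / 4 ->
  d%:R ^+ 2 / (16 * (n%:R * (eps * expR 1)) ^+ 2 * lam) <= r.
Proof.
move=> hd; have /andP[e0 e1] := eps01.
have E0 : 0 < expR 1 :> R by exact: expR_gt0.
apply: (private_rate (n := n%:R)) => // [|k k0]; first by rewrite !mulr_gt0.
have := @tradeoff _ (fun b ba => attack_total_le_dp c0 dens law law_n d1 d2 psi2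
  c2_gt0 x_cov a_gt0 box_risk ba (ltW e0) delta_ge0 (mem_set Mdp) k0 (ltW lam_gt0)).
move=> H.
have he : expR eps - 1 <= eps * expR 1.
  apply: le_trans (expRB1_le eps) _.
  by rewrite ler_wpM2l ?(ltW e0)// ler_expR ltW.
set q := (k * (lam * r) + k^-1) in H *.
have q0 : 0 <= q.
  by rewrite addr_ge0 ?invr_ge0 ?(ltW k0)// mulr_ge0 ?(ltW k0)// mulr_ge0// ltW.
have h3 : (expR eps - 1) * q <= eps * expR 1 * q by rewrite ler_wpM2r.
have h4 : n%:R * ((expR eps - 1) * q) <= n%:R * (eps * expR 1 * q).
  by rewrite ler_wpM2l// ltW.
have H' : d%:R / 2 <= n%:R * ((expR eps - 1) * q) / 2 + d%:R / 4.
  by apply: le_trans H _; rewrite mulrDr mulrA lerD2l.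
have -> : n%:R * (eps * expR 1) * q / 2 = n%:R * (eps * expR 1 * q) / 2 by ring.
have -> : d%:R / 4 = d%:R / 2 - d%:R / 4 :> R by lra.
by rewrite lerBlDr; apply: le_trans H' _; rewrite lerD2r ler_wpM2r.
Qed.

End rates.

Section constants.
Context {R : realType}.

Lemma rate_bounded (d n eps C1 : R) : 0 < d -> 0 < n -> 0 < C1 -> 0 < eps < 1 ->
  d <= C1 * n * eps ->
  d / n <= C1 /\ d ^+ 2 / (n ^+ 2 * eps ^+ 2) <= C1 ^+ 2.
Proof.
move=> d0 n0 C10 /andP[e0 e1] h; split.
  rewrite ler_pdivrMr//; apply: le_trans h _.
  by rewrite ler_piMr ?ltW// mulr_gt0.
have ne0 : 0 < n * eps by rewrite mulr_gt0.
rewrite -exprMn -expr_div_n lerXn2r ?nnegrE ?(ltW C10) ?(ltW (divr_gt0 d0 ne0))//.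
by rewrite ler_pdivrMr ?mulr_gt0// mulrA.
Qed.

(** The threshold on n is where n^(-gamma) drops below 1 / A. *)
Lemma large_sample (gamma A n : R) : 0 < gamma -> 0 < A -> 0 < n ->
  A `^ gamma^-1 <= n -> A * n `^ (- gamma) <= 1.
Proof.
move=> g0 A0 n0 h.
have : (A `^ gamma^-1) `^ gamma <= n `^ gamma.
  by rewrite ge0_ler_powR ?nnegrE ?powR_ge0 ?(ltW g0) ?(ltW n0).
rewrite -powRrM mulVf ?gt_eqF// powRr1 ?(ltW A0)// => h1.
by rewrite powRN ler_pdivrMr ?powR_gt0// mul1r.
Qed.

End constants.

Theorem theorem3p1 (R : realType)
    (gamma C1 C2 b0 C Kx c2 clo chi : R) :
  0 < gamma -> 0 < C1 -> 0 < C2 -> 0 < b0 -> 0 < clo ->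
  exists c : R, 0 < c /\
  forall (n d : nat) (eps delta : R)
    (psi : R -> R) (h : R -> R -> R) (cs : R -> R) (sigma : R)
    (nu : {sigma_finite_measure set R -> \bar R})
    (fx : probability (d.-tuple R) R)
    (P : d.-tuple R -> probability (obs R d) R)
    (Pn : d.-tuple R -> probability (n.-tuple (obs R d)) R),
  (0 < n)%N -> (0 < d)%N ->
  clo <= cs sigma <= chi ->
  (forall theta : R,
     probability_density nu (glm_density psi h cs sigma theta)) ->
  (forall beta, glm_law psi h cs sigma nu fx beta (P beta)) ->
  (forall beta, iid_law (P beta) (Pn beta)) ->
  cond_SG C Kx fx ->
  (forall t : R, derivable psi t 1 /\ derivable (psi^`())%classic t 1) ->
  (sup_norm (psi^`(2))%classic < c2%:E)%E ->
  d%:R <= C1 * n%:R * eps ->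
  0 < eps < 1 ->
  0 <= delta <= C2 * n%:R `^ (- (1 + gamma)) ->
  ((c * cs sigma * (d%:R / n%:R + d%:R ^+ 2 / (n%:R ^+ 2 * eps ^+ 2)))%:E
     <= private_minimax_risk (l2ball b0) Pn eps delta)%E.
Proof.
move=> g0 C10 C20 b00 clo0.
pose E1 : R := expR 1.
have E1_gt0 : 0 < E1 by exact: expR_gt0.
pose c2p : R := `|c2| + 1.
have c2p0 : 0 < c2p by rewrite ltr_wpDl.
pose kx : R := (`|Kx| + 1) ^+ 2.
have kx0 : 0 < kx by rewrite exprn_gt0// ltr_wpDl.
pose K0 := 8 * E1 * c2p * kx.
have K00 : 0 < K0 by rewrite !mulr_gt0.
pose chi' := Num.max chi clo.
have chi'0 : 0 < chi' by rewrite lt_max clo0 orbT.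
(* beyond the sample size N0, n delta is small enough for the privacy bound *)
pose A := 8 * C2 * b0 * (K0 / clo + 1).
have A0 : 0 < A by rewrite !mulr_gt0// addr_gt0// divr_gt0.
pose N0 := A `^ gamma^-1.
have N00 : 0 < N0 by rewrite powR_gt0.
(* constants of the rates of [risk_ge_nonprivate] and [risk_ge_private], after
   lam = K0 / c(sigma) *)
pose q1 := 2 / (9 * K0); pose q2 := (16 * E1 ^+ 2 * K0)^-1.
have q10 : 0 < q1 by rewrite divr_gt0// mulr_gt0.
have q20 : 0 < q2 by rewrite invr_gt0 mulr_gt0// mulr_gt0// exprn_gt0.
(* k1: large risk; k2: small samples, where only the first rate is available;
   k3: large samples, where the average of the two rates is used *)
pose k1 := b0 ^+ 2 / (144 * chi' * (C1 + C1 ^+ 2)).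
pose k2 := q1 / (1 + C1 ^+ 2 * N0).
pose k3 := Num.min q1 q2 / 2.
have C12 : 0 < C1 + C1 ^+ 2 by rewrite addr_gt0// exprn_gt0.
have C1N : 0 < 1 + C1 ^+ 2 * N0 by rewrite addr_gt0// mulr_gt0// exprn_gt0.
have k10 : 0 < k1 by rewrite divr_gt0 ?exprn_gt0// !mulr_gt0.
have k20 : 0 < k2 by rewrite divr_gt0.
have k30 : 0 < k3 by rewrite divr_gt0// lt_min q10.
pose c := Num.min k1 (Num.min k2 k3).
have c0 : 0 < c by rewrite !lt_min k10 k20.
exists c; split=> // n d eps delta psi h cs sigma nu fx P Pn n0 d0 /andP[clocs cschi].
move=> dens law law_n SG der psi2 dn eps01 /andP[delta0 deltaC].
have cs0 : 0 < cs sigma by exact: lt_le_trans clocs.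
have dR : 0 < d%:R :> R by rewrite ltr0n.
have nR : 0 < n%:R :> R by rewrite ltr0n.
have /andP[e0 e1] := eps01.
have [X_le Y_le] := rate_bounded dR nR C10 eps01 dn.
set X := d%:R / n%:R in X_le *; set Y := d%:R ^+ 2 / _ in Y_le *.
have X0 : 0 < X by rewrite divr_gt0.
have Y0 : 0 < Y by rewrite divr_gt0 ?mulr_gt0 ?exprn_gt0.
have psi2' t : `|(psi^`(2))%classic t| <= c2p.
  have h1 : (`|(psi^`(2))%classic t|%:E <= c2%:E)%E.
    by apply: le_trans (ltW psi2); apply: ereal_sup_ubound; exists t.
  by rewrite lee_fin in h1; rewrite (le_trans h1)// (le_trans (ler_norm _))// lerDl.
have x_cov u := cond_SG_second_moment u SG.
apply: le_ereal_inf_tmp => _ [M Mdp <-].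
set s := ereal_sup _.
have s_ub b : l2ball b0 b -> (sq_risk (Pn b) M b <= s)%E.
  by move=> bb; apply: ereal_sup_ubound; exists b.
have s0 : (0 <= s)%E.
  apply: le_trans (s_ub [tuple 0 | i < d] _).
    by apply: integral_ge0 => D _; apply: integral_ge0 => y _; rewrite lee_fin sqr_ge0.
  rewrite /l2ball /= /l2norm big1 ?sqrtr0 ?ltW// => i _.
  by rewrite tnth_mktuple expr0n.
case: s s_ub s0 => [r s_ub|_ _|_]; [|exact: leey|by []].
rewrite lee_fin => r0; rewrite lee_fin.
have XY0 : 0 <= X + Y by rewrite addr_ge0 ?ltW.
have bound k : c <= k -> k * cs sigma * (X + Y) <= r -> c * cs sigma * (X + Y) <= r.
  by move=> ck; apply: le_trans; rewrite ler_wpM2r// ler_wpM2r// ltW.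
have [rb|/ltW rb] := leP (b0 ^+ 2 / 144) r.
  apply: (bound k1); first by rewrite ge_min lexx.
  apply: le_trans rb; apply: (@le_trans _ _ (k1 * chi' * (C1 + C1 ^+ 2))).
    apply: ler_pM => //; first by rewrite mulr_ge0 ?ltW.
      by rewrite ler_pM2l// le_max cschi.
    exact: lerD.
  rewrite le_eqVlt; apply/orP; left; apply/eqP; rewrite /k1; field.
  by rewrite !gt_eqF.
pose lam := info cs sigma c2p kx.
have lamE : lam = K0 / cs sigma by rewrite /lam /info /K0 /E1; ring.
have lam_le : lam <= K0 / clo by rewrite lamE ler_pM2l// lef_pV2.
have d1 t := (der t).1; have d2 t := (der t).2.
have np : q1 * cs sigma * X <= r.
  have := risk_ge_nonprivate cs0 dens law law_n d1 d2 psi2' c2p0 kx0 x_cov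
    b00 n0 d0 s_ub rb.
  rewrite -/lam lamE; apply: le_trans.
  rewrite le_eqVlt; apply/orP; left; apply/eqP; rewrite /q1 /X; field.
  by rewrite !gt_eqF.
have [nN|Nn] := leP N0 n%:R.
  have pr : q2 * cs sigma * Y <= r.
    have := risk_ge_private cs0 dens law law_n d1 d2 psi2' c2p0 kx0 x_cov
      b00 n0 d0 eps01 delta0 r0 s_ub Mdp rb.
    rewrite -/lam => H; apply: le_trans (H _).
      rewrite lamE le_eqVlt; apply/orP; left; apply/eqP; rewrite /q2 /Y -/E1; field.
      by rewrite !gt_eqF.
    have An := large_sample g0 A0 nR nN.
    have nd : n%:R * delta <= C2 * n%:R `^ (- gamma).
      apply: (@le_trans _ _ (n%:R * (C2 * n%:R `^ (- (1 + gamma))))).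
        by rewrite ler_pM2l.
      rewrite mulrCA -{1}[n%:R](@powRr1 _ n%:R) ?(ltW nR)// -powRD.
        by rewrite opprD addrA subrr add0r.
      by apply/implyP => _; rewrite gt_eqF.
    have sd : 1 <= Num.sqrt d%:R :> R.
      by rewrite -[leLHS]sqrtr1 ler_wsqrtr// ler1n.
    have ab : b0 / Num.sqrt d%:R <= b0.
      by rewrite ler_pdivrMr ?(lt_le_trans _ sd)// ler_peMr// ltW.
    have -> : n%:R * (delta * (2 * (b0 / Num.sqrt d%:R)) * d%:R * (lam + 1)) =
      (n%:R * delta) * ((b0 / Num.sqrt d%:R) * (lam + 1)) * (2 * d%:R) by ring.
    have lam0 : 0 <= lam by rewrite lamE divr_ge0 ?ltW.
    have bd0 : 0 <= b0 / Num.sqrt d%:R by rewrite divr_ge0 ?sqrtr_ge0 ?(ltW b00).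
    have lam10 : 0 <= lam + 1 by rewrite addr_ge0.
    have h1 : (b0 / Num.sqrt d%:R) * (lam + 1) <= b0 * (K0 / clo + 1).
      by apply: ler_pM => //; rewrite lerD2r.
    have h2 : n%:R * delta * ((b0 / Num.sqrt d%:R) * (lam + 1)) <=
        C2 * n%:R `^ (- gamma) * (b0 * (K0 / clo + 1)).
      by apply: ler_pM => //; rewrite mulr_ge0// (ltW nR).
    apply: (@le_trans _ _ (C2 * n%:R `^ (- gamma) * (b0 * (K0 / clo + 1)) * (2 * d%:R))).
      by rewrite ler_wpM2r// mulr_ge0// ltW.
    rewrite (_ : _ * (2 * d%:R) = A * n%:R `^ (- gamma) * (d%:R / 4)); last first.
      by rewrite /A; field; rewrite gt_eqF.
    by rewrite -[leRHS]mul1r ler_wpM2r// divr_ge0// ltW.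
  apply: (bound k3); first by rewrite !ge_min lexx !orbT.
  have mq1 : Num.min q1 q2 * cs sigma * X <= r.
    by apply: le_trans np; rewrite ler_wpM2r ?(ltW X0)// ler_wpM2r ?(ltW cs0)// ge_min lexx.
  have mq2 : Num.min q1 q2 * cs sigma * Y <= r.
    by apply: le_trans pr; rewrite ler_wpM2r ?(ltW Y0)// ler_wpM2r ?(ltW cs0)// ge_min lexx orbT.
  rewrite /k3; move: (Num.min q1 q2) mq1 mq2 => q mq1 mq2; lra.
apply: (bound k2); first by rewrite !ge_min lexx !orbT.
apply: le_trans np.
have XN : 1 <= N0 * X.
  rewrite /X mulrA ler_pdivlMr// mul1r (le_trans (ltW Nn))//.
  by rewrite ler_peMr ?(ltW N00)// ler1n.
have YX : X + Y <= (1 + C1 ^+ 2 * N0) * X.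
  rewrite mulrDl mul1r lerD2l (le_trans Y_le)// -mulrA ler_peMr//.
  by rewrite exprn_ge0// ltW.
apply: (@le_trans _ _ (k2 * cs sigma * ((1 + C1 ^+ 2 * N0) * X))).
  by rewrite ler_wpM2l// mulr_ge0// ltW.
rewrite le_eqVlt; apply/orP; left; apply/eqP; rewrite /k2; field.
by rewrite gt_eqF.
Qed.
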